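(* Let $d\in\mathbb{N}$, and suppose $G$ is a (finitely generated) virtually nilpotent group with polynomial growth of degree $d$. Let $X$ be a finite generating set for $G$. Then \[ s_n(G,X)\ge\frac{n^d}{2^{d(d+2)}\,g\bigl(h(G)\bigr)^d}\ge\frac{n^d}{2^{d(d+2)}\,g(d)^d} \] for every $n\in\mathbb{N}$.
   Context: $\mathbb{N}$ is the set of strictly positive integers. For a group $G$ generated by a finite subset $X$, $s_n(G,X)$ is the number of elements of $G$ that can be expressed as a product of at most $n$ elements of $X\cup X^{-1}$. $G$ has polynomial growth if there are $C,d$ with $s_n(G,X)\le Cn^d$ for all $n$; its growth degree is the infimum of the $d$ for which such a $C$ exists (equivalently $\limsup_{n\to\infty}\frac{\log s_n(G,X)}{\log n}$), which is independent of $X$. For a finitely generated nilpotent group $H$ of class $c$ with lower central series $H=\gamma_1(H)\supseteq\gamma_2(H)\supseteq\cdots\supseteq\gamma_{c+1}(H)=\{1\}$, the Hirsch length is $h(H)=\sum_{i=1}^c r(i)$, where $r(i)$ is the torsion-free rank of $\gamma_i(H)/\gamma_{i+1}(H)$; for a group $G$ with a finite-index nilpotent subgroup $H$, $h(G):=h(H)$. $g(k)$ denotes the maximum order of a finite subgroup of $\mathrm{GL}_k(\mathbb{Z})$. *)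

(* Defs.v *)
From HB Require Import structures.
From mathcomp Require Import all_boot all_order all_algebra finmap.
From mathcomp Require Import boolp classical_sets cardinality reals exp.

Set Implicit Arguments.
Unset Strict Implicit.
Unset Printing Implicit Defensive.

Import Order.TTheory GRing.Theory Num.Theory.

Local Open Scope classical_set_scope.
Local Open Scope ring_scope.

Section Subgroups.
Variable G : groupType.
Implicit Types (H A B K : set G) (X : {fset G}).

Definition is_subgroup H :=
  H 1%g /\ forall x y, H x -> H y -> H (x * y^-1)%g.

Definition generated A : set G := smallest is_subgroup A.

Definition generates X := generated [set` X] = setT.

Definition finite_index H :=
  finite_set [set [set (g * h)%g | h in H] | g in [set: G]].

(* [lower_central H i] is gamma_i(H), indexed from gamma_1(H) = H. *)
Definition lower_central H (i : nat) : set G :=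
  iter i.-1 (fun K => generated [set commg x y | x in K & y in H]) H.

Definition nilpotent H := exists c : nat, lower_central H c.+1 = [set 1%g].

(* Infima and suprema of nonempty bounded subsets of nat are minima and
   maxima; [supremum 0 A] is 0 when A is empty or unbounded. *)
Definition nilpotency_class H : nat :=
  infimum 0%N [set c : nat | lower_central H c.+1 = [set 1%g]].

Definition zexpg (x : G) (z : int) : G :=
  match z with Posz n => (x ^+ n)%g | Negz n => (x ^- n.+1)%g end.

(* The torsion-free rank of the abelian group A / B, for B normal in A with
   abelian quotient: the largest number of elements of A that are linearly
   independent over the integers modulo B. *)
Definition torsion_free_rank A B : nat :=
  supremum 0%N [set r : nat | exists x : 'I_r -> G,
    (forall i, A (x i)) /\
    forall e : 'I_r -> int,
      B (\prod_(i < r) zexpg (x i) (e i))%g -> forall i, e i = 0].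

Definition nilpotent_hirsch_length H : nat :=
  (\sum_(1 <= i < (nilpotency_class H).+1)
     torsion_free_rank (lower_central H i) (lower_central H i.+1))%N.

Definition finite_index_nilpotent_subgroup H :=
  [/\ is_subgroup H, finite_index H & nilpotent H].

Definition word_ball X (n : nat) : set G :=
  [set g | exists w : seq G,
    [/\ (size w <= n)%N,
        (forall x, x \in w -> (x \in X) || ((x^-1)%g \in X)) &
        g = (\prod_(x <- w) x)%g]].

(* The set [word_ball X n] is finite, so that [fset_set] is its finite-set
   version (on infinite sets it would be empty). *)
Definition growth X (n : nat) : nat := #|` fset_set (word_ball X n)|.

Section Growth.
Variable R : realType.

Definition growth_exponents X : set R :=
  [set a | exists C : R, forall n : nat, (0 < n)%N ->
    (growth X n)%:R <= C * n%:R `^ a].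

Definition has_polynomial_growth X := growth_exponents X !=set0.

Definition growth_degree X : R := inf (growth_exponents X).

End Growth.
End Subgroups.

Definition virtually_nilpotent (G : groupType) :=
  exists H : set G, finite_index_nilpotent_subgroup H.

(* The growth degree does not depend on the finite generating set Y. *)
Definition polynomial_growth_of_degree (R : realType) (G : groupType) (a : R) :=
  exists Y : {fset G},
    [/\ generates Y, has_polynomial_growth R Y & growth_degree R Y = a].

(* The Hirsch length of a virtually nilpotent group, computed on some
   nilpotent subgroup of finite index; it does not depend on the choice. *)
Definition hirsch_length (G : groupType) : nat :=
  nilpotent_hirsch_length
    (xget [set: G] (@finite_index_nilpotent_subgroup G)).

Definition is_GLZ_subgroup (k : nat) (S : {fset 'M[int]_k}) :=
  [/\ forall A, A \in S -> A \in unitmx,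
      1%:M \in S &
      forall A B, A \in S -> B \in S -> A *m invmx B \in S].

(* The maximum order of a finite subgroup of GL_k(Z). *)
Definition max_GLZ_order (k : nat) : nat :=
  supremum 0%N [set m : nat |
    exists2 S : {fset 'M[int]_k}, is_GLZ_subgroup S & #|` S| = m].

(* Main.v *)
Require Import Defs.
From HB Require Import structures.
From mathcomp Require Import all_boot all_order all_algebra finmap.
From mathcomp Require Import boolp classical_sets cardinality reals exp.
From mathcomp Require Import zify ring.

Set Implicit Arguments.
Unset Strict Implicit.
Unset Printing Implicit Defensive.

Import Order.TTheory GRing.Theory Num.Theory.

Local Open Scope classical_set_scope.

(** Let [H] be a nilpotent subgroup of finite index and [N] its normal core, with
   class at most [c] and ranks [r k] of the quotients of its lower central series
   [gamma_(k+1)(N) / gamma_(k+2)(N)].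

   The degree of growth is the sum [D] of the [(k+1) * r k] (Bass-Guivarc'h). The
   upper bound ([nilpotent_ball_covered]) comes from collecting words: the
   letters are generators of weight [k+1] of the successive quotients, and a word
   of length [n] can be sorted at the price of O(n^w) letters of each weight [w],
   since a commutator of letters has at least the sum of their weights. Letters
   that are torsion modulo later ones contribute boundedly many exponents, the
   [r k] basis letters of weight [k+1] contribute O(n^(k+1)) each.

   The lower bound ([growth_lower_bound]) holds for every finitely generated group
   [K] and uses only the commutators of generators: modulo the next term of the
   series commutators are bimultiplicative, so a power with exponent below
   [q^(k+1)] of a commutator of weight [k+1] has length O(q), as one sees by
   writing the exponent in base [q]. The implied constants add up to at most [2^D]
   ([weights_le]); with a factor 2 from the length of the generators of the group
   [K] below and another from rounding, this gives [2 ^ (d * (d + 2))].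

   To control the index of the group to which the lower bound is applied, let [G]
   act by conjugation on the torsion-free parts Z^(r k) of the quotients for [N].
   This gives a representation in GL_h(Z), with [h] the sum of the [r k]; its image
   is finite as [N] acts trivially, so its kernel [K] has index [m <= g(h)]. By
   Schreier's method [K] is generated by elements of length less than [2 * m].
   Since [K] acts trivially on these quotients, its lower central series is
   commensurable with that of [N]; this is proved with the transfer
   ([lower_central_finite_index_step]), which plays the role of the theorem of
   Baer on groups with a term of the upper central series of finite index. Hence
   the ranks for [K] are at least those for [N], and the lower bound for [K] has
   the exponent [D = d]. The same argument applied to [H], which acts unipotently
   and therefore trivially ([unipotent_coordinates]), compares the ranks for [N]
   with those for [H], whose sum is the Hirsch length; that sum is at most the
   degree of growth, again by the lower bound.

   The value 0 of [max_GLZ_order k] stands for unbounded orders. The quotients by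
   its powers are then 0, and the inequalities are immediate. *)

(** * Subgroups, generated subgroups and balls *)

Section BasicSubgroups.
Local Open Scope group_scope.
Variable G : groupType.
Implicit Types (H A B K N P : set G) (x y g : G).

Lemma subgroup1 H : is_subgroup H -> H 1. Proof. by case. Qed.

Lemma subgroupV H x : is_subgroup H -> H x -> H x^-1.
Proof. by case=> H1 HD Hx; rewrite -[x^-1]mul1g; apply: HD. Qed.

Lemma subgroupM H x y : is_subgroup H -> H x -> H y -> H (x * y).
Proof.
move=> sH Hx Hy; rewrite -[y]invgK; case: (sH) => _; apply=> //.
exact: subgroupV.
Qed.

Lemma subgroupX H x n : is_subgroup H -> H x -> H (x ^+ n).
Proof.
move=> sH Hx; elim: n => [|n IH]; first exact: subgroup1.
by rewrite expgS; apply: subgroupM.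
Qed.

Lemma subgroupZ H x z : is_subgroup H -> H x -> H (zexpg x z).
Proof.
move=> sH Hx; case: z => n /=; first exact: subgroupX.
by apply: subgroupV => //; apply: subgroupX.
Qed.

Lemma subgroupJ H x y : is_subgroup H -> H x -> H y -> H (x ^ y).
Proof.
by move=> sH Hx Hy; apply: subgroupM; [|apply: subgroupV|apply: subgroupM].
Qed.

Lemma subgroupR H x y : is_subgroup H -> H x -> H y -> H [~ x, y].
Proof.
by move=> sH Hx Hy; apply: subgroupM; [|apply: subgroupV|apply: subgroupJ].
Qed.

Lemma subgroup_prod H I (r : seq I) (P : pred I) (F : I -> G) :
  is_subgroup H -> (forall i, P i -> H (F i)) -> H (\prod_(i <- r | P i) F i).
Proof.
move=> sH HF; elim/big_ind: _ => //; first exact: subgroup1.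
by move=> x y; apply: subgroupM.
Qed.

Lemma generated_subgroup A : is_subgroup (generated A).
Proof.
split=> [B [sB _]|x y gx gy B [sB AB]]; first exact: subgroup1.
by case: (sB) => _; apply; [apply: gx|apply: gy].
Qed.

Lemma sub_generated A : A `<=` generated A.
Proof. exact: sub_gen_smallest. Qed.

Lemma generated_sub A H : is_subgroup H -> A `<=` H -> generated A `<=` H.
Proof. exact: smallest_sub. Qed.

Lemma zexpgV x (z : int) : zexpg x (- z)%R = (zexpg x z)^-1.
Proof.
by case: z => [[|n]|n] /=; rewrite ?invg1 ?invgK.
Qed.

Lemma zexpg_nat x (n : nat) : zexpg x n = x ^+ n. Proof. by []. Qed.

Lemma zexpgS x (z : int) : zexpg x (z + 1)%R = zexpg x z * x.
Proof.
case: z => [n|[|n]].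
- by rewrite -PoszD addn1 /= expgSr.
- have -> : (Negz 0 + 1 = 0)%R by lia.
  by rewrite /= expg1 mulVg.
- have -> : (Negz n.+1 + 1 = Negz n)%R by lia.
  by rewrite /= [x ^+ n.+2]expgS invgM mulgVK.
Qed.

Lemma zexpgD x (y z : int) : zexpg x (y + z)%R = zexpg x y * zexpg x z.
Proof.
have nat_case (w : int) (n : nat) : zexpg x (w + Posz n)%R = zexpg x w * x ^+ n.
  elim: n => [|n IH]; first by rewrite addr0 mulg1.
  by rewrite -addn1 PoszD addrA zexpgS IH addn1 expgSr mulgA.
case: z => n; first exact: nat_case.
rewrite NegzE zexpgV /= -[in RHS](subrK (Posz n.+1) y) nat_case.
by rewrite mulgK.
Qed.

Definition normalizes g H := forall x, H x -> H (x ^ g).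

Definition normal_in N P := forall g, P g -> normalizes g N.

Lemma generated_normalizes A g :
  (forall x, A x -> generated A (x ^ g)) -> normalizes g (generated A).
Proof.
move=> Ag x gx; have sA := generated_subgroup A.
pose C := [set x | generated A (x ^ g)].
suff sAC : generated A `<=` C by exact: (sAC _ gx).
apply: generated_sub => //; split=> [|y z]; rewrite /C /= ?conj1g.
  exact: subgroup1.
rewrite conjMg conjVg => Cy Cz; apply: (subgroupM sA) => //.
exact: (subgroupV sA).
Qed.

End BasicSubgroups.

Section Balls.
Local Open Scope group_scope.
Variables (G : groupType) (X : {fset G}).
Implicit Types (x y g : G).

Lemma ball1 n : word_ball X n 1.
Proof. by exists [::]; split=> //; rewrite big_nil. Qed.

Lemma ballM m n x y : word_ball X m x -> word_ball X n y ->
  word_ball X (m + n) (x * y).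
Proof.
move=> [u [um uX ->]] [v [vn vX ->]]; exists (u ++ v); split.
- by rewrite size_cat leq_add.
- by move=> z; rewrite mem_cat => /orP[/uX|/vX].
- by rewrite big_cat.
Qed.

Lemma ball_le m n x : (m <= n)%N -> word_ball X m x -> word_ball X n x.
Proof. by move=> mn [u [um uX ->]]; exists u; split=> //; lia. Qed.

Lemma ballV n x : word_ball X n x -> word_ball X n x^-1.
Proof.
move=> [u [un uX ->]]; exists [seq z^-1 | z <- rev u]; split.
- by rewrite size_map size_rev.
- move=> z /mapP[y]; rewrite mem_rev => /uX yX ->.
  by rewrite invgK orbC.
- by rewrite big_map prodgV revK.
Qed.

Lemma ball_gen x : x \in X -> word_ball X 1 x.
Proof.
move=> xX; exists [:: x]; split=> //; last by rewrite big_seq1.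
by move=> z; rewrite inE => /eqP ->; rewrite xX.
Qed.

Lemma ballX m n x : word_ball X m x -> word_ball X (n * m) (x ^+ n).
Proof.
move=> xm; elim: n => [|n IH]; first exact: ball1.
by rewrite expgS mulSn; apply: ballM.
Qed.

Lemma ballR m n x y : word_ball X m x -> word_ball X n y ->
  word_ball X (2 * m + 2 * n) [~ x, y].
Proof.
move=> xm yn; rewrite /commg /conjg.
apply: (@ball_le (m + (n + (m + n)))); first by lia.
by apply: ballM; [apply: ballV|apply: ballM; [apply: ballV|apply: ballM]].
Qed.

Lemma ballS n g : word_ball X n.+1 g ->
  g = 1 \/ exists x h, [/\ word_ball X 1 x, word_ball X n h & g = x * h].
Proof.
move=> [[|x u] [us uX ->]]; first by left; rewrite big_nil.
right; exists x, (\prod_(y <- u) y); split; last by rewrite big_cons.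
  exists [:: x]; split=> //; last by rewrite big_seq1.
  by move=> z; rewrite inE => /eqP ->; apply: uX; rewrite inE eqxx.
by exists u; split=> // z zu; apply: uX; rewrite inE zu orbT.
Qed.

Lemma generated_ball g : generated [set` X] g -> exists n, word_ball X n g.
Proof.
pose B := [set g | exists n, word_ball X n g].
suff sXB : generated [set` X] `<=` B by move=> /sXB.
apply: generated_sub; last by move=> x xX; exists 1%N; apply: ball_gen.
split=> [|x y [m xm] [n yn]]; first by exists 0%N; apply: ball1.
by exists (m + n)%N; apply: ballM => //; apply: ballV.
Qed.

Lemma ball_generated H n : is_subgroup H -> [set` X] `<=` H ->
  word_ball X n `<=` H.
Proof.
move=> sH XH g [u [_ uX ->]]; rewrite big_seq; apply: subgroup_prod => // x xu.
by have /orP[/XH//|/XH] := uX x xu; move/(subgroupV sH); rewrite invgK.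
Qed.

Lemma ball1E x : word_ball X 1 x <-> [\/ x = 1, x \in X | x^-1 \in X].
Proof.
split.
  move=> [[|y [|z u]] [// _ uX ->]].
    by constructor 1; rewrite big_nil.
  rewrite big_seq1; have := uX y (mem_head _ _).
  by case/orP; [constructor 2|constructor 3].
case=> [->|/ball_gen//|/ball_gen/ballV]; first exact: ball1.
by rewrite invgK.
Qed.

Lemma finite_ball n : finite_set (word_ball X n).
Proof.
elim: n => [|n IH].
  apply: (@sub_finite_set _ _ [set (1 : G)]) => // g [[|x u] [// _ _ ->]].
  by rewrite big_nil.
pose S : set G := 1 |` ([set` X] `|` (fun x => x^-1) @` [set` X]).
have finS : finite_set S.
  rewrite /S !finite_setU; split=> //; split; first exact: finite_fset.
  by apply: finite_image; apply: finite_fset.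
apply: (@sub_finite_set _ _ (1 |` [set x * y | x in S & y in word_ball X n])).
  move=> g /ballS[->|[x [h [x1 hn ->]]]]; first by left.
  right; exists x; last by exists h.
  move/ball1E: x1 => [->|xX|xX]; [by left|by right; left|right; right].
  by exists x^-1 => //; rewrite invgK.
rewrite finite_setU; split=> //.
exact: finite_image2.
Qed.

Lemma growth_ge n (s : seq G) : uniq s ->
  (forall g, g \in s -> word_ball X n g) -> (size s <= growth X n)%N.
Proof.
move=> us sB; rewrite /growth cardfE cardE.
rewrite -(size_map val) -(undup_id us); rewrite /=.
apply: uniq_leq_size; first by rewrite undup_id.
move=> g; rewrite mem_undup => /sB gB.
have gF : g \in fset_set (word_ball X n).
  by rewrite in_fset_set ?inE //; apply: finite_ball.
by apply/mapP; exists [` gF]%fset; rewrite ?mem_enum.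
Qed.

Lemma growth_le n (s : seq G) :
  (forall g, word_ball X n g -> g \in s) -> (growth X n <= size s)%N.
Proof.
move=> Bs; rewrite /growth; apply: uniq_leq_size; first exact: fset_uniq.
move=> g; rewrite in_fset_set ?inE; last exact: finite_ball.
exact: Bs.
Qed.

End Balls.

(** * The lower central series *)

Section LowerCentral.
Local Open Scope group_scope.
Variable G : groupType.
Implicit Types (H A B K N P : set G) (x y g : G) (i j k : nat).

Lemma commMgR x y g : [~ x * y, g] = [~ x, g] ^ y * [~ y, g].
Proof. by rewrite /commg /conjg !gnorm. Qed.

Lemma commgMR x y g : [~ x, y * g] = [~ x, g] * [~ x, y] ^ g.
Proof. by rewrite /commg /conjg !gnorm. Qed.

Lemma commVgR x g : [~ x^-1, g] = ([~ x, g] ^ x^-1)^-1.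
Proof. by rewrite /commg /conjg !gnorm. Qed.

Lemma commgVR x g : [~ x, g^-1] = ([~ x, g] ^ g^-1)^-1.
Proof. by rewrite /commg /conjg !gnorm. Qed.

Lemma hall_witt x y g :
  [~ [~ x, y^-1], g] ^ y * [~ [~ y, g^-1], x] ^ g * [~ [~ g, x^-1], y] ^ x = 1.
Proof. by rewrite /commg /conjg !gnorm. Qed.

Lemma lower_centralS H k : lower_central H k.+2 =
  generated [set [~ x, y] | x in lower_central H k.+1 & y in H].
Proof. by []. Qed.

Lemma lower_central_subgroup H k : is_subgroup H ->
  is_subgroup (lower_central H k.+1).
Proof. by case: k => [//|k] _; apply: generated_subgroup. Qed.

Lemma lower_central_comm H k x y :
  lower_central H k.+1 x -> H y -> lower_central H k.+2 [~ x, y].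
Proof. by move=> kx Hy; apply: sub_generated; exists x => //; exists y. Qed.

Lemma lower_central_normalizes H k g :
  normalizes g H -> normalizes g (lower_central H k.+1).
Proof.
move=> gH; elim: k => [//|k IH]; rewrite lower_centralS.
apply: generated_normalizes => _ [x kx [y Hy <-]].
rewrite conjRg; apply: sub_generated; exists (x ^ g); first exact: IH.
by exists (y ^ g) => //; apply: gH.
Qed.

Lemma subgroup_normalizes H g : is_subgroup H -> H g -> normalizes g H.
Proof. by move=> sH Hg x Hx; apply: subgroupJ. Qed.

Lemma lower_centralJ H k x y : is_subgroup H ->
  lower_central H k.+1 x -> H y -> lower_central H k.+1 (x ^ y).
Proof.
move=> sH kx Hy; apply: lower_central_normalizes kx.
exact: subgroup_normalizes.
Qed.

Lemma lower_central_sub H k : is_subgroup H ->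
  lower_central H k.+2 `<=` lower_central H k.+1.
Proof.
move=> sH; apply: generated_sub; first exact: lower_central_subgroup.
move=> _ [x kx [y Hy <-]]; have sK := lower_central_subgroup k sH.
apply: (subgroupM sK); first exact: (subgroupV sK).
exact: lower_centralJ.
Qed.

Lemma lower_central_le H i j : is_subgroup H -> (i <= j)%N ->
  lower_central H j.+1 `<=` lower_central H i.+1.
Proof.
move=> sH; elim: j => [|j IH]; first by rewrite leqn0 => /eqP ->.
rewrite leq_eqVlt => /predU1P[-> //|ij] x /(lower_central_sub sH).
exact: IH.
Qed.

Lemma lower_central_subT H k : is_subgroup H -> lower_central H k.+1 `<=` H.
Proof. by move=> sH; apply: (@lower_central_le H 0). Qed.

Lemma lower_central_mono N P k : N `<=` P ->
  lower_central N k.+1 `<=` lower_central P k.+1.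
Proof.
move=> NP; elim: k => [//|k IH].
apply: generated_sub; first exact: generated_subgroup.
move=> _ [x /IH kx [y /NP Hy <-]]; exact: lower_central_comm.
Qed.

(** Hall-Witt turns the commutator of [x] with [[~ y, h]] into commutators
   whose second entry has smaller weight. *)
Lemma lower_central_comm2 H i j x y : is_subgroup H ->
  lower_central H i.+1 x -> lower_central H j.+1 y ->
  lower_central H (i + j).+2 [~ x, y].
Proof.
move=> sH; elim: j => [|j IH] in i x y *.
  by rewrite addn0; apply: lower_central_comm.
move=> ix jy; rewrite addnS.
have sK := lower_central_subgroup (i + j).+2 sH.
pose C := [set y | H y /\ lower_central H (i + j).+3 [~ y, x]].
have Hx : H x by apply: lower_central_subT ix.
have sC : is_subgroup C.
  split=> [|u v [Hu ux] [Hv vx]].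
    by split; [exact: subgroup1|rewrite comm1g; apply: subgroup1].
  split; first by apply: subgroupM => //; apply: subgroupV.
  rewrite commMgR; apply: (subgroupM sK).
    by apply: lower_centralJ => //; apply: subgroupV.
  rewrite commVgR; apply: (subgroupV sK).
  by apply: lower_centralJ => //; apply: subgroupV.
suff sKC : lower_central H j.+2 `<=` C.
  by rewrite -invgR; apply: (subgroupV sK); case: (sKC _ jy).
apply: generated_sub => // _ [z jz [h Hh <-]].
have Hz : H z by apply: lower_central_subT jz.
split; first exact: subgroupR.
have := hall_witt z h^-1 x; rewrite invgK -mulgA => /eqP.
rewrite mulg_eq1 => /eqP HW; rewrite -[[~ [~ z, h], x]](conjgKV h) HW.
apply: lower_centralJ => //; apply: (subgroupV sK).
apply: (subgroupM sK); apply: lower_centralJ => //; try exact: Hz.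
- rewrite -addSn; apply: IH => //; rewrite -invgR; apply: (subgroupV (lower_central_subgroup _ sH)).
  apply: lower_central_comm; last exact: subgroupV.
  exact: (subgroupV (lower_central_subgroup _ sH)).
- apply: lower_central_comm; last exact: subgroupV.
  apply: IH => //.
  exact: (subgroupV (lower_central_subgroup _ sH)).
Qed.

End LowerCentral.

(** * Homomorphisms to abelian groups *)

Section AdditiveOn.
Local Open Scope group_scope.
Variables (G : groupType) (V : zmodType).
Implicit Types (A B : set G) (f : G -> V) (x y g : G).

Definition additive_on A f :=
  forall x y, A x -> A y -> f (x * y) = (f x + f y)%R.

Variables (A : set G) (f : G -> V).
Hypotheses (sA : is_subgroup A) (fA : additive_on A f).

Lemma additive_on1 : f 1 = 0%R.
Proof.
have A1 := subgroup1 sA; apply: (@addrI _ (f 1)).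
by rewrite -fA // mulg1 addr0.
Qed.

Lemma additive_onV x : A x -> f x^-1 = (- f x)%R.
Proof.
move=> Ax; apply/eqP; rewrite -addr_eq0; apply/eqP.
by rewrite -fA ?mulVg ?additive_on1 //; apply: subgroupV.
Qed.

Lemma additive_onX x n : A x -> f (x ^+ n) = (f x *+ n)%R.
Proof.
move=> Ax; elim: n => [|n IH]; first by rewrite additive_on1.
by rewrite expgS mulrS fA ?IH //; apply: subgroupX.
Qed.

Lemma additive_onZ x z : A x -> f (zexpg x z) = (f x *~ z)%R.
Proof.
move=> Ax; case: z => n /=; first by rewrite additive_onX.
by rewrite additive_onV ?additive_onX //; apply: subgroupX.
Qed.

Lemma additive_on_prod I (r : seq I) (F : I -> G) : (forall i, A (F i)) ->
  f (\prod_(i <- r) F i) = (\sum_(i <- r) f (F i))%R.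
Proof.
move=> AF; elim: r => [|i r IH]; first by rewrite !big_nil additive_on1.
by rewrite !big_cons fA ?IH //; apply: subgroup_prod.
Qed.

Lemma additive_on_eq x y : A x -> A y -> f x = f y <-> f (x^-1 * y) = 0%R.
Proof.
move=> Ax Ay; rewrite fA ?additive_onV //; last exact: subgroupV.
rewrite addrC; split=> [->|/subr0_eq //]; exact: subrr.
Qed.

End AdditiveOn.

(** * Finitely generated abelian groups *)

Section Lattices.
Local Open Scope ring_scope.

Lemma intr_mx_inj m n : injective (@map_mx int rat intr m n).
Proof.
move=> A B /matrixP AB; apply/matrixP => i j.
by have := AB i j; rewrite !mxE => /intr_inj.
Qed.

(** The matrices [Pr] and [Sc] are the projection onto the torsion-free
   quotient of Z^k by the subgroup [Rel] and a section of it; they are read off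
   the Smith normal form of a matrix of largest rank with rows in [Rel]. *)
Lemma lattice_quotient k (Rel : set 'rV[int]_k) :
  Rel 0 -> (forall u v, Rel u -> Rel v -> Rel (u - v)) ->
  exists r (Pr : 'M[int]_(k, r)) (Sc : 'M[int]_(r, k)) (m : nat),
    [/\ (0 < m)%N, Sc *m Pr = 1%:M, forall e, Rel e -> e *m Pr = 0 &
        forall e, e *m Pr = 0 -> Rel (e *+ m)].
Proof.
move=> R0 RB.
have RN u : Rel u -> Rel (- u) by move=> ?; rewrite -sub0r; apply: RB.
have RD u v : Rel u -> Rel v -> Rel (u + v).
  by move=> Ru Rv; rewrite -[v]opprK; apply: RB => //; apply: RN.
have RX u n : Rel u -> Rel (u *+ n).
  by move=> Ru; elim: n => [//|n IH]; rewrite mulrS; apply: RD.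
have RZ u (z : int) : Rel u -> Rel (z *: u).
  move=> Ru; rewrite -[z]intz scaler_int; case: z => n.
    by rewrite -pmulrn; apply: RX.
  by rewrite NegzE mulrNz -pmulrn; apply: RN; apply: RX.
pose toQ m n := @map_mx int rat intr m n.
pose good n := `[< exists t (F : 'M[int]_(t, k)),
  (forall i, Rel (row i F)) /\ \rank (toQ _ _ F) = n >].
have [] := @ex_maxnP good k.
- by exists 0%N; apply/asboolP; exists 0%N, 0; split=> [[]//|]; apply/eqP; rewrite mxrank_eq0; apply/eqP; apply/matrixP; case.
- by move=> n /asboolP[t [F [_ <-]]]; apply: rank_leq_col.
move=> n /asboolP[t [F [FR rF]]] nmax.
have [L uL [S uS [d _ FE]]] := int_Smith_normal_form F.
pose J := [pred j : 'I_k | ~~ ((j < t)%N && (d`_j != 0))].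
pose D : 'M[int]_(t, k) := \matrix_(i, j) (d`_i *+ (i == j :> nat)).
have DJ i j : j \in J -> D i j = 0.
  rewrite !inE /D mxE => jJ; case: eqP => // ij.
  by move: jJ; rewrite -ij ltn_ord /= negbK => /eqP ->; rewrite mul0rn.
pose m := (\prod_(i < t | (d`_i)%R != 0%R) `|(d`_i)%R|)%N.
exists #|J|, (colsub enum_val (invmx S)), (rowsub enum_val S), m; split.
- by apply: prodn_cond_gt0 => i; rewrite absz_gt0.
- apply/matrixP => i j; have := congr1 (fun M : 'M_k => M (enum_val i) (enum_val j)) (mulmxV uS).
  rewrite !mxE (inj_eq enum_val_inj) => <-.
  by apply: eq_bigr => l _; rewrite !mxE.
- move=> e Re; have eF : (toQ _ _ e <= toQ _ _ F)%MS.
    have FeF : (toQ _ _ F <= toQ _ _ (col_mx F e))%MS.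
      by rewrite /toQ map_col_mx -addsmxE addsmxSl.
    have := mxrank_leqif_sup FeF; rewrite rF => /leqifP.
    case: ifP => [FF _|_ lt].
      by apply: submx_trans FF; rewrite /toQ map_col_mx -addsmxE addsmxSr.
    have /nmax : good (\rank (toQ _ _ (col_mx F e))).
      apply/asboolP; exists (t + 1)%N, (col_mx F e); split=> // i.
      case: (split_ordP i) => j ->; first by rewrite rowKu.
      by rewrite rowKd (ord1 j) row_id.
    by rewrite leqNgt lt.
  have /submxP[x xE] := eF.
  apply: intr_mx_inj; apply/matrixP => i j; rewrite !mxE.
  have : toQ _ _ (e *m invmx S) = x *m toQ _ _ L *m toQ _ _ D.
    rewrite /toQ map_mxM -/(toQ _ _ e) xE FE /toQ !map_mxM -!mulmxA; congr (_ *m (_ *m _)).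
    by rewrite -map_mxM mulmxV // map_mx1 mulmx1.
  move/matrixP/(_ i (enum_val j)); rewrite [in X in X -> _]mxE.
  have -> : (e *m invmx S) i (enum_val j) =
    \sum_l e i l * colsub enum_val (invmx S) l j.
    by rewrite mxE; apply: eq_bigr => l _; rewrite !mxE.
  move=> ->; rewrite mxE big1 // => l _; rewrite [X in _ * X]mxE DJ ?mulr0 //.
  exact: enum_valP.
- move=> e eP; pose y := e *m invmx S.
  pose yn l := if insub l is Some j then y 0 (j : 'I_k) else 0.
  have ynE (j : 'I_k) : yn j = y 0 j by rewrite /yn valK.
  have yJ j : j \in J -> y 0 j = 0.
    move=> jJ; have := congr1 (fun M : 'M_(1, _) => M 0 (enum_rank_in jJ j)) eP.
    rewrite !mxE => yE; rewrite -[RHS]yE; apply: eq_bigr => l _.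
    by rewrite !mxE enum_rankK_in.
  pose c : 'rV[int]_t := \row_i ((m %/ d`_i)%Z * yn i).
  have yD : y *+ m = c *m D.
    apply/rowP => j; rewrite mulmxnE [RHS]mxE; have [jJ|jJ] := boolP (j \in J).
      rewrite yJ // mul0rn big1 // => i _; by rewrite DJ ?mulr0.
    move: (jJ); rewrite !inE negbK => /andP[jt dj].
    rewrite (bigD1 (Ordinal jt)) //= big1 => [|i ij]; last first.
      rewrite [D _ _]mxE (_ : (_ == _) = false) ?mulr0n ?mulr0 //.
      by apply: contraNF ij => /eqP ij; apply/eqP/val_inj.
    rewrite addr0 [c _ _]mxE [D _ _]mxE eqxx mulr1n /= ynE.
    rewrite mulrAC divzK; first by rewrite mulrC -mulr_natr natz.
    rewrite /m (bigD1 (Ordinal jt)) //= PoszM dvdz_mulr //.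
    by rewrite dvdzE absz_nat.
  suff -> : e *+ m = (c *m invmx L) *m F.
    rewrite mulmx_sum_row; elim/big_ind: _ => // i _.
    exact: RZ.
  rewrite FE -/D -!mulmxA mulKmx // mulmxA -yD /y.
  by rewrite -!scaler_nat -scalemxAl -mulmxA mulVmx // mulmx1.
Qed.

End Lattices.

(** * Abelian sections *)

Section Sections.
Local Open Scope group_scope.
Variable G : groupType.
Implicit Types (A B H N P : set G) (x y g : G).

Definition abelian_section A B :=
  [/\ is_subgroup A, is_subgroup B, B `<=` A &
      forall x y, A x -> A y -> B [~ x, y]].

Lemma lower_central_section H k : is_subgroup H ->
  abelian_section (lower_central H k.+1) (lower_central H k.+2).
Proof.
move=> sH; split; try exact: lower_central_subgroup.
  exact: lower_central_sub.
move=> x y kx ky; apply: lower_central_comm => //.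
exact: lower_central_subT ky.
Qed.

(** The quotient is carried by chosen coset representatives: a subtype of [G]
   has the choice structure that a [zmodType] needs. *)
Lemma section_quotient A B : abelian_section A B ->
  exists (V : zmodType) (p : G -> V),
    [/\ additive_on A p, forall x, A x -> (p x = 0%R <-> B x) &
        forall v, exists2 x, A x & p x = v].
Proof.
case=> sA sB BA AB.
pose c x := xget 1 [set y | A y /\ B (x^-1 * y)].
have cP x : A x -> A (c x) /\ B (x^-1 * c x).
  move=> Ax; rewrite /c; case: xgetP => // /(_ x); case.
  by split=> //; rewrite mulVg; apply: subgroup1.
have BJ x y : A x -> B y -> B (y ^ x).
  move=> Ax By; rewrite -[y ^ x](mulVKg y); apply: (subgroupM sB) => //.
  exact: (AB y x (BA _ By) Ax).
have cE x y : A x -> A y -> c x = c y <-> B (x^-1 * y).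
  move=> Ax Ay; have [[_ Bx] [_ By]] := (cP x Ax, cP y Ay); split=> [cxy|Bxy].
    rewrite cxy in Bx.
    rewrite (_ : x^-1 * y = (x^-1 * c y) * (y^-1 * c y)^-1); last by rewrite !gnorm.
    by apply: (subgroupM sB) => //; apply: (subgroupV sB).
  congr (xget _ _); apply/seteqP; split=> z [Az Bz]; split=> //.
    rewrite (_ : y^-1 * z = (x^-1 * y)^-1 * (x^-1 * z)); last by rewrite !gnorm.
    by apply: (subgroupM sB) => //; apply: (subgroupV sB).
  rewrite (_ : x^-1 * z = (x^-1 * y) * (y^-1 * z)); last by rewrite !gnorm.
  exact: (subgroupM sB).
have cM x x' y y' : A x -> A x' -> A y -> A y' ->
    c x = c x' -> c y = c y' -> c (x * y) = c (x' * y').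
  move=> Ax Ax' Ay Ay' /cE - /(_ Ax Ax') Bx /cE - /(_ Ay Ay') By.
  apply/cE; try exact: (subgroupM sA).
  rewrite (_ : (x * y)^-1 * (x' * y') = (x^-1 * x') ^ y * (y^-1 * y')); last first.
    by rewrite /conjg !gnorm.
  by apply: (subgroupM sB) => //; apply: BJ.
pose T := {x : G | `[<A x>] && (c x == x)}.
have TA (u : T) : A (val u) by have /andP[/asboolP] := valP u.
have Tc (u : T) : c (val u) = val u by have /andP[_ /eqP] := valP u.
have cA x : A x -> A (c x) by move=> /cP[].
have cc x : A x -> c (c x) = c x.
  move=> Ax; apply/esym/cE => //; first exact: cA.
  by have [] := cP x Ax.
have pP x : A x -> `[<A (c x)>] && (c (c x) == c x).
  by move=> Ax; rewrite cc // eqxx andbT; apply/asboolP/cA.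
have A1 := subgroup1 sA.
pose p x : T := insubd (Sub (c 1) (pP 1 A1) : T) (c x).
have pE x : A x -> val (p x) = c x by move=> Ax; rewrite insubdK //; exact: (pP _ Ax).
have pval (u : T) : p (val u) = u by apply: val_inj; rewrite pE.
pose add (u v : T) := p (val u * val v).
pose opp (u : T) := p (val u)^-1.
have pM x y : A x -> A y -> p (x * y) = add (p x) (p y).
  move=> Ax Ay; apply: val_inj; rewrite /add !pE //; try exact: (subgroupM sA).
    by apply: cM => //; try exact: cA; rewrite cc.
  by apply: (subgroupM sA); apply: cA.
have pX (P : T -> Prop) : (forall x, A x -> P (p x)) -> forall u, P u.
  by move=> HP u; rewrite -[u]pval; apply: HP.
have AM x y : A x -> A y -> A (x * y) by exact: subgroupM.
have addA : associative add.
  apply: (pX _) => x Ax; apply: (pX _) => y Ay; apply: (pX _) => z Az.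
  by rewrite -!pM ?mulgA //; apply: AM.
have addC : commutative add.
  apply: (pX _) => x Ax; apply: (pX _) => y Ay; rewrite -!pM //.
  apply: val_inj; rewrite !pE; try exact: AM.
  apply/cE; try exact: AM.
  rewrite (_ : (x * y)^-1 * (y * x) = [~ y, x]); first exact: AB.
  by rewrite /commg /conjg !gnorm.
have add0 : left_id (p 1) add.
  by apply: (pX _) => x Ax; rewrite -pM // mul1g.
have addN : left_inverse (p 1) opp add.
  apply: (pX _) => x Ax; have AV := subgroupV sA (cA _ Ax).
  rewrite /opp pE // -pM //; apply: val_inj; rewrite !pE //; last exact: AM.
  apply/cE => //; first exact: AM.
  rewrite mulg1 invgM invgK.
  by have [] := cP x Ax.
pose V := HB.pack_for zmodType T (GRing.isZmodule.Build T addA addC add0 addN).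
exists V, p; split=> [x y Ax Ay|x Ax|v].
- exact: pM.
- split=> [p0|Bx].
    have : c x = c 1 by rewrite -!pE //; congr val; exact: p0.
    by move/cE => - /(_ Ax A1); rewrite mulg1 => /(subgroupV sB); rewrite invgK.
  apply: val_inj; rewrite /= !pE //; apply/cE => //.
  by rewrite mulg1; apply: (subgroupV sB).
- by exists (val v) => //; apply: pval.
Qed.

End Sections.

Section AbelianGroups.
Local Open Scope ring_scope.

(** The kernel of [phi] is finite because some [m] > 0 annihilates it: two of its
   elements with coefficients congruent modulo [m] differ by [m] times an element
   of the kernel. *)
Lemma fg_zmod_coordinates (V : zmodType) k (s : 'I_k -> V) :
  (forall v, exists e : 'rV[int]_k, v = \sum_i s i *~ e 0 i) ->
  exists r (phi : V -> 'rV[int]_r) (b : 'I_r -> V),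
    [/\ {morph phi : x y / x + y}, forall j, phi (b j) = (delta_mx 0 j)%R,
        exists2 m, (0 < m)%N & forall v, phi v = 0 -> v *+ m = 0 &
        exists (F : finType) (f : V -> F), forall v w,
          phi v = 0 -> phi w = 0 -> f v = f w -> v = w].
Proof.
move=> sV; pose ev (e : 'rV[int]_k) : V := \sum_i s i *~ e 0 i.
have evB e e' : ev (e - e') = ev e - ev e'.
  by rewrite /ev -sumrB; apply: eq_bigr => i _; rewrite !mxE mulrzBr.
have ev0 : ev 0 = 0 by have := evB 0 0; rewrite !subrr.
have evN e : ev (- e) = - ev e by have := evB 0 e; rewrite ev0 !sub0r.
have evD e e' : ev (e + e') = ev e + ev e'.
  by rewrite -[e' in LHS]opprK evB evN opprK.
have evX e n : ev (e *+ n) = ev e *+ n.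
  by elim: n => [|n IH]; rewrite ?ev0 // !mulrS evD IH.
have [|u v Ru Rv|r [Pr [Sc [m [m_gt0 SP PR PX]]]]] :=
    @lattice_quotient k [set e | ev e = 0].
- exact: ev0.
- by rewrite /= evB Ru Rv subrr.
have [co coE] : {co : V -> 'rV[int]_k & forall v, ev (co v) = v}.
  have /choice[co coE] : forall v, exists e, ev e = v.
    by move=> v; have [e ->] := sV v; exists e.
  by exists co.
have PE e e' : ev e = ev e' -> e *m Pr = e' *m Pr.
  move=> ee; apply/eqP; rewrite -subr_eq0 -mulmxBl; apply/eqP/PR.
  by rewrite /= evB ee subrr.
exists r, (fun v => co v *m Pr), (fun j => ev (row j Sc)); split.
- by move=> x y; rewrite -mulmxDl; apply: PE; rewrite evD !coE.
- move=> j; rewrite (@PE _ (row j Sc)) ?coE // -row_mul SP.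
  by apply/rowP => i; rewrite !mxE eqxx /= eq_sym.
- by exists m => // v /PX; rewrite /= evX coE.
exists {ffun 'I_k -> 'I_m.+1}.
exists (fun v => [ffun i => inord `|(co v 0%R i %% m)%Z|]) => v w v0 w0 vw.
have m_neq0 : Posz m != 0 by lia.
have vwi i : (co v 0%R i %% m = co w 0%R i %% m)%Z.
  have modE (z : int) : `|(z %% m)%Z|%N = @inord m `|(z %% m)%Z|.
    rewrite inordK //; have := ltz_mod z m_neq0; have := modz_ge0 z m_neq0.
    by lia.
  have /(congr1 val) := congr1 (fun f : {ffun 'I_k -> 'I_m.+1} => f i) vw.
  rewrite !ffunE /= -!modE => /(congr1 Posz).
  by rewrite !gez0_abs ?modz_ge0.
pose e : 'rV[int]_k := \row_i ((co v 0%R i - co w 0%R i)%R %/ m)%Z.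
have eE : co v - co w = e *+ m.
  apply/rowP => i; rewrite mulmxnE !mxE -mulr_natr natz divzK //.
  by rewrite -eqz_mod_dvd; apply/eqP.
have eP : e *m Pr = 0.
  apply/rowP => i; have := congr1 (fun M : 'M_(1, r) => M 0 i) (mulmxBl (co v) (co w) Pr).
  rewrite v0 w0 subrr eE -scaler_nat -scalemxAl !mxE => /eqP.
  by rewrite mulf_eq0 natz (negPf m_neq0) => /eqP.
apply/eqP; rewrite -subr_eq0 -(coE v) -(coE w) -evB eE; apply/eqP.
exact: PX.
Qed.

End AbelianGroups.

Section Coordinates.
Local Open Scope group_scope.
Variable G : groupType.
Implicit Types (A B H N P : set G) (x y g : G).

(** A coset may carry several values of [f]; this makes the notion stable under
   restriction of [A]. *)
Definition finite_index_in A B :=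
  exists (F : finType) (f : G -> F),
    forall x y, A x -> A y -> f x = f y -> B (x^-1 * y).

(** [phi] identifies [A] modulo the elements that are torsion modulo [B] with
   Z^r, the images of the [b j] forming the standard basis. *)
Definition coordinates A B r (phi : G -> 'rV[int]_r) (b : 'I_r -> G) :=
  [/\ additive_on A phi, forall j, A (b j), forall j, phi (b j) = (delta_mx 0 j)%R,
      forall x, A x -> (phi x = 0%R <-> exists2 m, (0 < m)%N & B (x ^+ m)) &
      finite_index_in [set x | A x /\ phi x = 0%R] B].

Definition generated_modulo A B k (s : 'I_k -> G) :=
  (forall i, A (s i)) /\
  forall x, A x -> exists e : 'I_k -> int,
    B (x^-1 * \prod_(i < k) zexpg (s i) (e i)).

Lemma coordinates_exist A B k (s : 'I_k -> G) :
  abelian_section A B -> generated_modulo A B s ->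
  exists r (phi : G -> 'rV[int]_r) (b : 'I_r -> G), coordinates A B phi b.
Proof.
move=> AB [As sAB]; have [V [p [pA pB pV]]] := section_quotient AB.
have [sA sB BA _] := AB.
have [|r [phi [b [phiD phib [m m_gt0 phim] [F [f fE]]]]]] :=
    @fg_zmod_coordinates V k (p \o s).
  move=> v; have [x Ax <-] := pV v; have [e xe] := sAB x Ax.
  exists (\row_i e i)%R.
  have Ae : A (\prod_(i < k) zexpg (s i) (e i)).
    by apply: subgroup_prod => // i _; apply: subgroupZ.
  have /(additive_on_eq sA pA Ax Ae) -> : p (x^-1 * \prod_(i < k) zexpg (s i) (e i)) = 0%R.
    by apply/pB => //; apply: BA.
  rewrite (additive_on_prod sA pA) => [|i]; last exact: subgroupZ.
  by apply: eq_bigr => i _; rewrite (additive_onZ sA pA) // mxE.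
have /choice[c cE] : forall j, exists x, A x /\ p x = b j.
  by move=> j; have [x Ax <-] := pV (b j); exists x.
have phi0 : phi 0%R = 0%R by apply: (@addrI _ (phi 0%R)); rewrite -phiD !addr0.
have phiX v n : phi (v *+ n)%R = (phi v *+ n)%R.
  by elim: n => [|n IH]; rewrite ?mulr0n // !mulrS phiD IH.
exists r, (phi \o p), c; split.
- by move=> x y Ax Ay; rewrite /= pA // phiD.
- by move=> j; case: (cE j).
- by move=> j; rewrite /= (cE j).2 phib.
- move=> x Ax /=; split=> [/phim pm|[n n_gt0 Bn]].
    exists m => //; apply/pB; first exact: subgroupX.
    by rewrite (additive_onX sA pA).
  have : phi (p (x ^+ n)) = 0%R by rewrite (iffRL (pB _ _)) //; apply: BA.
  rewrite (additive_onX sA pA) // phiX => /rowP px; apply/rowP => j.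
  have /eqP := px j; rewrite mulmxnE !mxE mulrn_eq0.
  by rewrite eqn0Ngt n_gt0 /= => /eqP.
- exists F, (f \o p) => x y [Ax x0] [Ay y0] /= /fE pxy.
  apply/pB; first by apply: subgroupM => //; apply: subgroupV.
  by apply/(additive_on_eq sA pA) => //; apply: pxy.
Qed.

End Coordinates.

(** * Torsion-free ranks *)

Section Ranks.
Local Open Scope ring_scope.

Lemma supremum_nat_max (S : set nat) n :
  S n -> (forall m, S m -> (m <= n)%N) -> supremum 0%N S = n.
Proof.
move=> Sn nmax; have n_sup : supremums S n.
  by split=> [m /nmax|m]; [rewrite leEnat|apply].
rewrite /supremum ifF; last by apply/negP => /eqP S0; rewrite S0 in Sn.
by apply: xget_subset1 => //; apply: is_subset1_supremums.
Qed.

Lemma int_left_kernel m n (M : 'M[int]_(m, n)) : (n < m)%N ->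
  exists2 e : 'rV[int]_m, e != 0 & e *m M = 0.
Proof.
move=> nm; have [L uL [S _ [d _ ->]]] := int_Smith_normal_form M.
pose l := Ordinal nm; exists (row l (invmx L)).
  apply/eqP => l0; have := congr1 (fun A => row l A) (mulVmx uL).
  rewrite row_mul l0 mul0mx => /rowP/(_ l).
  by rewrite !mxE eqxx => /eqP.
rewrite -row_mul !mulmxA mulVmx // mul1mx row_mul.
rewrite [row l _](_ : _ = 0) ?mul0mx //; apply/rowP => j; rewrite !mxE.
by rewrite gtn_eqF.
Qed.

End Ranks.

Section SectionRanks.
Local Open Scope group_scope.
Variable G : groupType.
Implicit Types (A B : set G).

Definition independent_modulo A B r (x : 'I_r -> G) :=
  (forall i, A (x i)) /\
  forall e : 'I_r -> int,
    B (\prod_(i < r) zexpg (x i) (e i)) -> forall i, e i = 0%R.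

Variables (A B : set G) (r : nat) (phi : G -> 'rV[int]_r) (b : 'I_r -> G).
Hypotheses (AB : abelian_section A B) (Ab : coordinates A B phi b).

Let sA : is_subgroup A. Proof. by case: AB. Qed.
Let phiA : additive_on A phi. Proof. by case: Ab. Qed.

Lemma coordinates_eq0 x : B x -> phi x = 0%R.
Proof.
case: AB Ab => _ sB BA _ [_ _ _ k0 _] Bx.
by apply/k0; [apply: BA|exists 1%N].
Qed.

Lemma coordinates_prod k (x : 'I_k -> G) (e : 'I_k -> int) :
  (forall i, A (x i)) ->
  phi (\prod_(i < k) zexpg (x i) (e i)) =
    ((\row_i e i) *m \matrix_(i < k) phi (x i))%R.
Proof.
move=> Ax; rewrite (additive_on_prod sA phiA) => [|i]; last exact: subgroupZ.
rewrite mulmx_sum_row; apply: eq_bigr => i _.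
by rewrite (additive_onZ sA phiA) // mxE rowK -scaler_int intz.
Qed.

Lemma coordinates_independent : independent_modulo A B b.
Proof.
case: Ab => _ bA phib _ _; split=> // e /coordinates_eq0.
rewrite coordinates_prod //; set M := (X in (_ *m X)%R).
rewrite (_ : M = 1%:M)%R.
  by rewrite mulmx1 => /rowP e0 i; have := e0 i; rewrite !mxE.
by apply/row_matrixP => i; rewrite rowK phib rowE mulmx1.
Qed.

(** A linear relation between the coordinates of [k] > [r] elements holds between
   the elements modulo torsion, so that a multiple of it holds modulo [B]. *)
Lemma independent_modulo_le k (x : 'I_k -> G) :
  independent_modulo A B x -> (k <= r)%N.
Proof.
move=> [xA x0]; rewrite leqNgt; apply/negP => rk.
have [e e0 eM] := int_left_kernel (\matrix_(i < k) phi (x i))%R rk.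
have Ax : A (\prod_(i < k) zexpg (x i) (e ord0 i)).
  by apply: subgroup_prod => // i _; apply: subgroupZ.
have := @coordinates_prod k x (e ord0) xA.
set u := (X in (X *m _)%R); rewrite (_ : u = e); last by apply/rowP => i; rewrite mxE.
rewrite eM; case: (Ab) => _ _ _ k0 _ /(k0 _ Ax)[m m_gt0].
case: (section_quotient AB) => V [p [pA pB _]].
rewrite -(pB _ (subgroupX m sA Ax)) (additive_onX sA pA) // => pm.
case/eqP: e0; apply/rowP => i; rewrite mxE.
suff /(_ i)/eqP : forall i, (e ord0 i *+ m = 0)%R.
  by rewrite mulrn_eq0 eqn0Ngt m_gt0 => /eqP.
apply: x0; apply/pB; first by apply: subgroup_prod => // j _; apply: subgroupZ.
rewrite -[RHS]pm !(additive_on_prod sA pA) => [|j|j]; try exact: subgroupZ.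
rewrite -sumrMnl; apply: eq_bigr => j _.
by rewrite !(additive_onZ sA pA) // -mulr_natr natz mulrzA.
Qed.

Lemma torsion_free_rank_coordinates : torsion_free_rank A B = r.
Proof.
apply: supremum_nat_max; first by exists b; apply: coordinates_independent.
by move=> k [x /independent_modulo_le].
Qed.

(** The coordinates of the generators span Z^r, so that their matrix has rational
   rank [r] and contains an invertible square matrix. *)
Lemma independent_generators k (s : 'I_k -> G) : generated_modulo A B s ->
  exists f : 'I_r -> 'I_k, independent_modulo A B (s \o f).
Proof.
move=> [As sAB]; pose M := (\matrix_(l < k) phi (s l))%R : 'M[int]_(k, r).
have fullM : row_full (map_mx intr M : 'M[rat]_(k, r)).
  apply/row_fullP.
  have /choice[E EP] : forall j, exists e : 'I_k -> int,
      B ((b j)^-1 * \prod_(i < k) zexpg (s i) (e i)).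
    by case: Ab => _ bA _ _ _ j; apply: sAB.
  exists (map_mx intr (\matrix_(j, i) E j i)%R); rewrite -map_mxM.
  rewrite -[RHS](@map_mx1 _ _ intr); congr map_mx.
  apply/row_matrixP => j; rewrite row_mul; set v := row j _; rewrite (_ : v = \row_i E j i)%R.
    have Ae : A (\prod_(i < k) zexpg (s i) (E j i)).
      by apply: subgroup_prod => // i _; apply: subgroupZ.
    rewrite -coordinates_prod // rowE mulmx1; case: (Ab) => _ bA <- _ _.
    by apply/esym/(additive_on_eq sA phiA) => //; apply: coordinates_eq0.
  by apply/rowP => i; rewrite !mxE.
exists (fullrankfun fullM); split=> [i|e]; first exact: As.
move/coordinates_eq0; rewrite coordinates_prod /= => [|i]; last exact: As.
set N := (X in (_ *m X)%R) => eN.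
have uN : (map_mx intr N : 'M[rat]_r) \in unitmx.
  rewrite -row_full_unit; have := fullrowsub_full fullM.
  set W := rowsub _ _; rewrite (_ : W = map_mx intr N)%R //.
  by apply/matrixP => i j; rewrite !mxE.
have : map_mx intr (\row_i e i)%R = 0%R :> 'rV[rat]_r.
  by apply/eqP; rewrite -(mulmxK uN (map_mx _ _)) -map_mxM eN map_mx0 mul0mx.
by move=> /rowP e0 i; have := e0 i; rewrite !mxE => /eqP; rewrite intr_eq0 => /eqP.
Qed.

End SectionRanks.

(** * Collecting weighted words *)

Section Covering.
Local Open Scope group_scope.
Variable G : groupType.
Implicit Types (A B : set G).

Definition covered N A := exists2 s : seq G, (size s <= N)%N & forall g, A g -> g \in s.

Lemma covered_le M N A B : (M <= N)%N -> A `<=` B -> covered M B -> covered N A.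
Proof.
move=> MN AB [s sM Bs]; exists s; first exact: leq_trans MN.
by move=> g /AB /Bs.
Qed.

Lemma coveredM M N A B : covered M A -> covered N B ->
  covered (M * N) [set x * y | x in A & y in B].
Proof.
move=> [s sM As] [u uN Bu]; exists [seq x * y | x <- s, y <- u].
  by rewrite size_allpairs leq_mul.
move=> _ [x Ax [y By <-]]; apply: (allpairs_f (fun x y => x * y)).
  exact: As.
exact: Bu.
Qed.

End Covering.

Lemma leq_expnD x y i : (0 < i)%N -> (x ^ i + y ^ i <= (x + y) ^ i)%N.
Proof.
case: i => // i _; elim: i => [|i IH]; first by rewrite !expn1.
rewrite expnS [y ^ _]expnS [(x + y) ^ _]expnS.
apply: leq_trans (leq_mul (leqnn _) IH); rewrite mulnDl !mulnDr; lia.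
Qed.

Lemma absz_divz_le (z : int) (m : nat) : (0 < m)%N -> (`|(z %/ m)%Z| <= `|z|)%N.
Proof.
move=> m_gt0; have m_neq0 : Posz m != 0%R by lia.
move: (divz_eq z m) (ltz_mod z m_neq0) (modz_ge0 z m_neq0).
move: (z %/ m)%Z (z %% m)%Z => q r zE rm r0.
have [q0|q0] := lerP 0%R q.
  have : (q <= q * m)%R by nia.
  by lia.
have : ((q + 1) * m <= q + 1)%R by nia.
by lia.
Qed.

Section WeightedWords.
Local Open Scope group_scope.
Variables (G : groupType) (L : nat) (t : nat -> G) (w : nat -> nat).
Implicit Types (p : nat * bool) (u : seq (nat * bool)) (v : nat -> nat) (x y g : G).

Definition letter p : G := if p.2 then t p.1 else (t p.1)^-1.

Definition eval_word u : G := \prod_(p <- u) letter p.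

Definition letter_count k u := count (fun p => p.1 == k) u.

Definition word_set v : set G :=
  [set g | exists2 u, forall k, (letter_count k u <= v k)%N & g = eval_word u].

(** Letters of index at least [a] and weight at least [j], those of weight [i]
   occurring O(n^(i-j)) times: this is the number that appears when one of
   weight [j] is moved past O(n^l) letters of weight [l]. *)
Definition word_bound a j C n : nat -> nat := fun k =>
  if [&& a <= k, k < L & j <= w k]%N then (C * n ^ (w k - j))%N else 0%N.

Lemma letter_count_cons k p u :
  letter_count k (p :: u) = ((p.1 == k) + letter_count k u)%N.
Proof. by []. Qed.

Lemma word_set1 v : word_set v 1.
Proof. by exists [::] => //; rewrite /eval_word big_nil. Qed.

Lemma word_set_le v v' : (forall k, v k <= v' k)%N -> word_set v `<=` word_set v'.
Proof.
by move=> vv' _ [u uv ->]; exists u => // k; apply: leq_trans (vv' k).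
Qed.

Lemma word_setM v v' x y : word_set v x -> word_set v' y ->
  word_set (fun k => v k + v' k)%N (x * y).
Proof.
move=> [u uv ->] [u' uv' ->]; exists (u ++ u'); last by rewrite /eval_word big_cat.
by move=> k; rewrite /letter_count count_cat; apply: leq_add; [apply: uv|apply: uv'].
Qed.

Lemma word_setV v x : word_set v x -> word_set v x^-1.
Proof.
move=> [u uv ->]; exists [seq (p.1, ~~ p.2) | p <- rev u].
  by move=> k; rewrite /letter_count count_map count_rev; apply: uv.
rewrite /eval_word big_map -[u in LHS]revK -prodgV.
by apply: eq_bigr => -[k []] _; rewrite /letter /= ?invgK.
Qed.

Lemma word_setX v x n : word_set v x -> word_set (fun k => n * v k)%N (x ^+ n).
Proof.
move=> vx; elim: n => [|n IH]; first exact: word_set1.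
by rewrite expgS; apply: word_set_le (word_setM vx IH) => k; rewrite mulSn.
Qed.

Lemma word_setZ v x z : word_set v x ->
  word_set (fun k => `|z| * v k)%N (zexpg x z).
Proof.
move=> vx; case: z => n; first exact: word_setX.
by apply: word_setV; apply: word_setX.
Qed.

Lemma word_set_letter v p : (0 < v p.1)%N -> word_set v (letter p).
Proof.
move=> v_gt0; exists [:: p]; last by rewrite /eval_word big_seq1.
by move=> k; rewrite /letter_count /= addn0; case: eqP => // <-.
Qed.

(** Transport of a bound on letters to a bound on words. *)
Lemma word_set_eval v v' N (f : G -> G) x :
    (forall y y', f (y * y') = f y * f y') -> f 1 = 1 ->
    (forall p, (0 < v p.1)%N -> word_set v' (f (letter p))) ->
    (forall k, (L <= k)%N -> v k = 0%N) -> (forall k, (v k <= N)%N) ->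
  word_set v x -> word_set (fun k => (L * N) * v' k)%N (f x).
Proof.
move=> fM f1 fl vL vN [u uv ->]; have uL : (size u <= L * N)%N.
  have -> : size u = \sum_(k < L) letter_count k u.
    elim: (u) uv => [|p s IH] uv; first by rewrite big1.
    rewrite [size _]/= IH; last by move=> k; apply: leq_trans (uv k); rewrite letter_count_cons leq_addl.
    under [in RHS]eq_bigr do rewrite letter_count_cons.
    rewrite big_split /=.
    have pL : (p.1 < L)%N.
      rewrite ltnNge; apply/negP => /vL p0; have := uv p.1.
      by rewrite p0 /letter_count /= eqxx.
    rewrite (_ : (\sum_(i < L) (p.1 == i))%N = 1%N) ?add1n //.
    rewrite (bigD1 (Ordinal pL)) //= eqxx big1 // => k; rewrite eq_sym -val_eqE /=.
    by move/negPf ->.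
  rewrite -[L in X in (_ <= X)%N]card_ord -sum_nat_const.
  by apply: leq_sum => k _; apply: leq_trans (uv k) (vN k).
have : forall p, p \in u -> word_set v' (f (letter p)).
  move=> p pu; apply: fl; apply: leq_trans (uv p.1).
  by rewrite -has_count; apply/hasP; exists p.
move=> ful; elim: (u) (L * N)%N uL ful => [|p s IH] M sM ful.
  by rewrite /eval_word big_nil f1; apply: word_set1.
case: M sM => // M sM; rewrite /eval_word big_cons fM.
apply: (@word_set_le (fun k => v' k + M * v' k)%N) => [k|]; first by rewrite mulSn.
apply: word_setM; first by apply: ful; rewrite mem_head.
by apply: IH => // q qs; apply: ful; rewrite inE qs orbT.
Qed.

Hypothesis w_gt0 : forall k, (0 < w k)%N.

Lemma word_bound_le a j C a' j' C' n k : (0 < n)%N -> (a' <= a)%N -> (j' <= j)%N ->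
  (C <= C')%N -> (word_bound a j C n k <= word_bound a' j' C' n k)%N.
Proof.
move=> n0 aa jj CC; rewrite /word_bound; case: ifP => // /and3P[ak kL jw].
rewrite (leq_trans aa ak) kL (leq_trans jj jw) /=.
by rewrite leq_mul // leq_pexp2l //; lia.
Qed.

(** A gain [i] in weight pays for [n ^ i] repetitions. *)
Lemma word_bound_shift a i j C n N k : (0 < n)%N -> (N <= n ^ i)%N ->
  (N * word_bound a (i + j) C n k <= word_bound a j C n k)%N.
Proof.
move=> n0 Nn; rewrite /word_bound; case: ifP => [/and3P[ak kL jw]|]; last by rewrite muln0.
rewrite ak kL ifT; last by lia.
rewrite mulnCA leq_mul2l; apply/orP; right.
apply: (@leq_trans (n ^ i * n ^ (w k - (i + j)))); first by rewrite leq_mul2r Nn orbT.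
by rewrite -expnD leq_pexp2l //; lia.
Qed.

Lemma word_bound_scale a j C C' n k :
  (C * word_bound a j C' n k = word_bound a j (C * C') n k)%N.
Proof. by rewrite /word_bound; case: ifP; rewrite ?muln0 // mulnA. Qed.

Lemma word_bound_rescale a C n k :
  (word_bound a 0 C n k <= word_bound a 0 1 (C * n) k)%N.
Proof.
rewrite /word_bound; case: ifP => // _; rewrite subn0 mul1n expnMn leq_mul2r.
apply/orP; right; rewrite -[X in (X <= _)%N]expn1; case: C => [|C].
  by rewrite exp0n.
by rewrite leq_pexp2l.
Qed.

Variable M : nat.
Hypothesis letterR : forall p q, (q.1 < p.1)%N -> (p.1 < L)%N ->
  word_set (word_bound p.1.+1 (w q.1 + w p.1) M 1) [~ letter p, letter q].

(** Conjugating [e] times multiplies [letter p] by [e] conjugates of the commutator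
   [[~ letter p, letter q]], whose letters come later and have weight at least
   [w q.1 + w p.1]. By downward induction on the index of [p] the conjugates of
   these are controlled, and the gain in weight absorbs the factor
   [e <= n ^ w q.1]. *)
Lemma letter_conj : exists C, forall p q n e, (0 < n)%N -> (e <= n ^ w q.1)%N ->
  (q.1 < p.1)%N -> (p.1 < L)%N ->
  exists2 z, word_set (word_bound p.1.+1 (w p.1) C n) z &
    letter p ^ (letter q ^+ e) = letter p * z.
Proof.
suff H b : exists C, forall p q n e, (0 < n)%N -> (e <= n ^ w q.1)%N ->
    (q.1 < p.1)%N -> (p.1 < L)%N -> (L - b <= p.1)%N ->
    exists2 z, word_set (word_bound p.1.+1 (w p.1) C n) z &
      letter p ^ (letter q ^+ e) = letter p * z.
  by have [C HC] := H L; exists C => p q n e; move: (HC p q n e); rewrite subnn; auto.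
elim: b => [|b [C HC]].
  by exists 0%N => p q n e _ _ _; rewrite subn0 ltnNge => /negPf ->.
exists (C + L * M * C.+1)%N => p q n e n0 en qp pL bp.
have [bp'|pb] := leqP (L - b) p.1.
  have [//|z zC ->] := HC p q n e n0 en qp pL; exists z => //.
  by apply: word_set_le zC => k; apply: word_bound_le => //; lia.
pose K := word_bound p.1.+1 (w q.1 + w p.1) (L * M * C.+1) n.
have step f : (f <= n ^ w q.1)%N -> word_set K ([~ letter p, letter q] ^ (letter q ^+ f)).
  move=> fn.
  pose K' := word_bound p.1.+1 (w q.1 + w p.1) C.+1 n.
  apply: (@word_set_le (fun k => (L * M) * K' k)%N) => [k|].
    by rewrite /K' word_bound_scale.
  apply: (@word_set_eval _ K' M (fun x => x ^ (letter q ^+ f)) _ _ _ _ _ _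
            (letterR qp pL)).
  - by move=> y y'; rewrite conjMg.
  - by rewrite conj1g.
  - move=> r; rewrite {1}/word_bound; case: ifP => // /and3P[pr rL wr] _.
    have qr : (q.1 < r.1)%N by apply: leq_trans pr; rewrite ltnW.
    have br : (L - b <= r.1)%N by lia.
    have [z zC ->] := HC r q n f n0 fn qr rL br.
    apply: (@word_set_le (fun k => word_bound p.1.+1 (w q.1 + w p.1) 1 n k +
        word_bound p.1.+1 (w q.1 + w p.1) C n k)%N) => [k|].
      by rewrite /K' /word_bound; case: ifP => //; lia.
    apply: word_setM.
      apply: word_set_letter; rewrite /word_bound pr rL wr /= mul1n.
      by rewrite expn_gt0 n0.
    apply: word_set_le zC => k; apply: word_bound_le => //; lia.
  - by move=> k Lk; rewrite /word_bound; case: ifP => //; lia.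
  - by move=> k; rewrite /word_bound exp1n muln1; case: ifP.
suff [z zK ->] : exists2 z, word_set (fun k => e * K k)%N z &
    letter p ^ (letter q ^+ e) = letter p * z.
  exists z => //; apply: word_set_le zK => k.
  apply: leq_trans (word_bound_shift _ _ _ _ _ _) _ => //.
  by apply: word_bound_le => //; lia.
elim: e en => [|e IH] en; first by exists 1; [apply: word_set1|rewrite conjg1 mulg1].
have [|z zK zE] := IH; first by lia.
exists (z * [~ letter p, letter q] ^ (letter q ^+ e)).
  apply: (@word_set_le (fun k => e * K k + K k)%N) => [k|]; first by rewrite mulSn addnC.
  by apply: word_setM => //; apply: step; lia.
rewrite mulgA -zE expgS conjgM -conjMg; congr (_ ^ _).
by rewrite /commg mulVKg.
Qed.

(** Moving the occurrences of the first letter to the left replaces every other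
   letter by a conjugate, to which [letter_conj] applies; as there are at most
   [n ^ w k] occurrences of the k-th letter, the numbers of new letters stay of the
   same order. *)
Lemma collect_letter a : (a < L)%N -> exists C, forall n x, (0 < n)%N ->
  word_set (word_bound a 0 1 n) x ->
  exists z y, [/\ (`|z| <= n ^ w a)%N, word_set (word_bound a.+1 0 1 (C * n)) y &
                  x = zexpg (t a) z * y].
Proof.
move=> aL; have [C HC] := letter_conj.
exists (L * C.+1)%N => n _ n0 [u un ->].
pose V u k := (\sum_(p <- u | p.1 != a) word_bound a.+1 (w p.1) C.+1 n k)%N.
have ua : all (fun p => (a <= p.1)%N && (p.1 < L)%N) u.
  apply/allP => p pu; have : (0 < letter_count p.1 u)%N.
    by rewrite -has_count; apply/hasP; exists p.
  move/leq_trans => /(_ _ (un p.1)); rewrite /word_bound.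
  by case: ifP => // /and3P[-> ->].
have una : (letter_count a u <= n ^ w a)%N.
  by apply: leq_trans (un a) _; rewrite /word_bound leqnn aL /= mul1n subn0.
have [z [y [zu yV ->]]] : exists z y, [/\ (`|z| <= letter_count a u)%N,
    word_set (V u) y & eval_word u = zexpg (t a) z * y].
  elim: {un} u ua una => [|p u IH] /=.
    by move=> _ _; exists 0%R, 1; split=> //; [apply: word_set1|rewrite /eval_word big_nil mulg1].
  move=> /andP[/andP[ap pL] ua] una; have [||z [y [zu yV uE]]] := IH => //.
    by apply: leq_trans una; rewrite leq_addl.
  rewrite /eval_word big_cons -/(eval_word u) uE.
  have [pa|pa] := eqVneq p.1 a.
    exists ((if p.2 then 1 else -1) + z)%R, y; split.
    - by rewrite add1n; case: (p.2); lia.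
    - by apply: word_set_le yV => k; rewrite /V big_cons pa eqxx.
    - rewrite mulgA; congr (_ * _); rewrite zexpgD; congr (_ * _).
      by rewrite /letter pa; case: (p.2); rewrite /= ?expg1.
  exists z; have [q [e [qa ze ->]]] : exists q e, [/\ q.1 = a, e = `|z|%N &
      zexpg (t a) z = letter q ^+ e].
    exists (a, if z is Posz _ then true else false), `|z|%N; split=> //.
    by case: (z) => m; rewrite /letter //= expVgn.
  have qp : (q.1 < p.1)%N by rewrite qa ltn_neqAle eq_sym pa.
  have en : (e <= n ^ w q.1)%N.
    by rewrite ze qa; apply: leq_trans zu (leq_trans _ una); rewrite leq_addl.
  have [z' z'C pq] := HC p q n e n0 en qp pL.
  exists ((letter p * z') * y); split=> //.
  - apply: (@word_set_le (fun k => word_bound a.+1 (w p.1) C.+1 n k + V u k)%N) => [k|].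
        by rewrite /V big_cons pa.
      apply: word_setM => //.
      apply: (@word_set_le (fun k => word_bound a.+1 (w p.1) 1 n k +
        word_bound a.+1 (w p.1) C n k)%N) => [k|].
        by rewrite /word_bound; case: ifP => //; lia.
      apply: word_setM.
        apply: word_set_letter; rewrite /word_bound ifT ?mul1n ?expn_gt0 ?n0 //.
        by rewrite pL leqnn ltn_neqAle eq_sym pa ap.
      by apply: word_set_le z'C => k; apply: word_bound_le => //; lia.
  - by rewrite -pq /conjg !gnorm.
exists z, y; split=> //; first exact: leq_trans una.
apply: word_set_le yV => x; apply: leq_trans (word_bound_rescale _ _ _ _).
have sumE (F : nat -> nat) s : all (fun p => (a <= p.1)%N && (p.1 < L)%N) s ->
    (\sum_(p <- s) F p.1 = \sum_(k < L) letter_count k s * F k)%N.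
  elim: s => [_|p s IH]; first by rewrite big_nil big1.
  rewrite [all _ _]/= => /andP[/andP[_ pL] /IH sE]; rewrite big_cons sE.
  under [RHS]eq_bigr do rewrite letter_count_cons mulnDl.
  rewrite big_split /=; congr addn.
  rewrite (bigD1 (Ordinal pL)) //= eqxx mul1n big1 ?addn0 // => k.
  by rewrite eq_sym -val_eqE /= => /negPf ->.
apply: (@leq_trans (\sum_(p <- u) word_bound a.+1 (w p.1) C.+1 n x)).
  by rewrite /V [X in (_ <= X)%N](bigID (fun p => p.1 != a)) leq_addr.
rewrite (sumE (fun k => word_bound a.+1 (w k) C.+1 n x)) //.
rewrite -word_bound_scale -[L in X in (_ <= X)%N]card_ord -sum_nat_const.
apply: leq_sum => k _; have := un k; rewrite {1}/word_bound.
case: ifP => [_|_]; last by rewrite leqn0 => /eqP ->.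
rewrite mul1n subn0 => uk.
apply: leq_trans (leq_mul uk (leqnn _)) _.
by rewrite -{2}[w k]addn0; apply: word_bound_shift.
Qed.

Variable fin : pred nat.
Hypothesis fin_letter : forall a, (a < L)%N -> fin a ->
  exists2 m, (0 < m)%N & word_set (word_bound a.+1 (w a) M 1) (t a ^+ m).

(** After collection a letter with a power expressible by later letters needs only
   boundedly many exponents, any other letter [k] needs O(n ^ w k). *)
Lemma weighted_growth : exists C, forall n, (0 < n)%N ->
  covered (C * n ^ \sum_(k < L | ~~ fin k) w k) (word_set (word_bound 0 0 1 n)).
Proof.
pose D a := (\sum_(k < L | (a <= k)%N && ~~ fin k) w k)%N.
suff H b : (b <= L)%N -> exists C, forall n, (0 < n)%N ->
    covered (C * n ^ D (L - b)%N) (word_set (word_bound (L - b) 0 1 n)).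
  by have := H L (leqnn L); rewrite subnn.
elim: b => [_|b IH bL].
  exists 1%N => n n0; exists [:: 1]; first by rewrite /= mul1n expn_gt0 n0.
  move=> _ [u uv ->]; rewrite inE; case: u uv => [|p u] uv.
    by rewrite /eval_word big_nil.
  have := uv p.1; rewrite /letter_count /= eqxx /word_bound subn0.
  by case: ifP => // /and3P[]; lia.
have [|C HC] := IH; first by lia.
pose a := (L - b.+1)%N; have aL : (a < L)%N by rewrite /a; lia.
have aE : (L - b)%N = a.+1 by rewrite /a; lia.
rewrite -/a; rewrite aE in HC.
have [K HK] := collect_letter aL.
have DE : D a = ((if fin a then 0 else w a) + D a.+1)%N.
  rewrite /D; case: ifPn => fa.
    rewrite add0n; apply: eq_bigl => k; rewrite [in RHS]ltn_neqAle.
    by case: eqP => //= <-; rewrite fa andbF.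
  rewrite (bigD1 (Ordinal aL)) /=; last by rewrite leqnn.
  congr addn; apply: eq_bigl => k; rewrite [in RHS]ltn_neqAle -val_eqE /= eq_sym.
  by rewrite andbC andbA.
have [fa|fa] := boolP (fin a).
  have [m m0 mP] := fin_letter aL fa.
  exists (m * (C * (K + M).+1 ^ D a.+1))%N => n n0.
  have KMn : (0 < (K + M).+1 * n)%N by rewrite muln_gt0.
  have : covered m [set t a ^+ i | i in [set i | (i < m)%N]].
    exists [seq t a ^+ i | i <- iota 0 m]; first by rewrite size_map size_iota.
    by move=> _ [i im <-]; apply: map_f; rewrite mem_iota.
  move=> /coveredM/(_ (HC _ KMn)); apply: covered_le => [|x].
    by rewrite DE fa add0n expnMn -!mulnA.
  move=> /HK - /(_ n0)[z [y [zn yP ->]]].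
  have m_neq0 : Posz m != 0%R by lia.
  exists (t a ^+ `|(z %% m)%Z|).
    exists `|(z %% m)%Z|%N => //=; have := ltz_mod z m_neq0.
    by have := modz_ge0 z m_neq0; lia.
  exists (zexpg (t a ^+ m) (z %/ m)%Z * y); last first.
    rewrite mulgA; congr (_ * _).
    have -> : t a ^+ `|(z %% m)%Z| = zexpg (t a) (z %% m)%Z.
      by rewrite -zexpg_nat gez0_abs // modz_ge0.
    rewrite [in RHS](divz_eq z m) addrC [in RHS]zexpgD; congr (_ * _).
    case: (z %/ m)%Z => i /=; first by rewrite -expgnA mulnC.
    rewrite NegzE mulNr zexpgV; congr (_ ^-1).
    by rewrite -PoszM /= -expgnA mulnC.
  apply: (@word_set_le (fun k => word_bound a.+1 0 1 (M * n) k +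
                                 word_bound a.+1 0 1 (K * n) k)%N) => [k|].
    rewrite /word_bound; case: ifP => // _; rewrite !mul1n subn0.
    apply: leq_trans (leq_expnD _ _ (w_gt0 k)) _.
    by rewrite -mulnDl leq_exp2r // leq_mul2r; apply/orP; right; lia.
  apply: word_setM => //.
  apply: word_set_le (word_setZ (z %/ m)%Z mP) => k.
  apply: leq_trans (word_bound_rescale _ _ _ _).
  apply: leq_trans (word_bound_shift a.+1 0 M k n0 zn); rewrite addn0.
  apply: leq_mul.
    exact: absz_divz_le.
  rewrite /word_bound; case: ifP => // _; rewrite leq_mul2l.
  by apply/orP; right; rewrite exp1n expn_gt0 n0.
exists (4 * (C * K.+1 ^ D a.+1))%N => n n0.
have Kn : (0 < K.+1 * n)%N by rewrite muln_gt0.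
have : covered (4 * n ^ w a) [set zexpg (t a) z | z in [set z | (`|z| <= n ^ w a)%N]].
  exists ([seq t a ^+ i | i <- iota 0 (n ^ w a).+1] ++
          [seq t a ^- i | i <- iota 0 (n ^ w a).+1]).
    rewrite size_cat !size_map !size_iota.
    have : (0 < n ^ w a)%N by rewrite expn_gt0 n0.
    by lia.
  move=> _ [[] i im <-]; rewrite mem_cat; apply/orP; [left|right].
    by apply: (map_f (fun i => t a ^+ i)); rewrite mem_iota add0n ltnS.
  apply: (map_f (fun i => t a ^- i) (x := i.+1)).
  by rewrite mem_iota add0n ltnS; move: im; rewrite /= ?abszE; lia.
move=> /coveredM/(_ (HC _ Kn)); apply: covered_le => [|x].
  rewrite DE (negPf fa) expnD expnMn; apply: eq_leq.
  by rewrite -!mulnA; congr muln; rewrite mulnCA; congr muln; rewrite mulnCA.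
move=> /HK - /(_ n0)[z [y [zn yP ->]]].
exists (zexpg (t a) z); first by exists z.
exists y => //; apply: word_set_le yP => k; rewrite /word_bound.
case: ifP => // _; rewrite !mul1n leq_exp2r ?subn0 //.
by rewrite leq_mul2r leqnSn orbT.
Qed.

End WeightedWords.

(** * Growth of nilpotent groups from above *)

Section SimpleCommutators.
Local Open Scope group_scope.
Variable G : groupType.
Implicit Types (A B H N P : set G) (x y g : G) (Y : seq G).

Fixpoint simple_commutators Y k : seq G :=
  if k is k'.+1 then [seq [~ x, y] | x <- simple_commutators Y k', y <- Y] else Y.

Definition generated_modulo_seq A B (s : seq G) :=
  generated_modulo A B (fun i : 'I_(size s) => nth 1 s i).

Lemma span_subgroup A B k (s : 'I_k -> G) : abelian_section A B ->
    (forall i, A (s i)) ->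
  is_subgroup [set x | A x /\
    exists e : 'I_k -> int, B (x^-1 * \prod_(i < k) zexpg (s i) (e i))].
Proof.
move=> AB As; have [V [p [pA pB _]]] := section_quotient AB.
have [sA sB BA _] := AB.
have Ase (e : 'I_k -> int) : A (\prod_(i < k) zexpg (s i) (e i)).
  by apply: subgroup_prod => // i _; apply: subgroupZ.
have pE (x : G) (e : 'I_k -> int) : A x ->
    B (x^-1 * \prod_(i < k) zexpg (s i) (e i)) <-> p x = (\sum_i p (s i) *~ e i)%R.
  move=> Ax; have AVx := subgroupV sA Ax.
  rewrite -pB; last exact: subgroupM.
  rewrite -(additive_on_eq sA pA Ax (Ase e)) (additive_on_prod sA pA) => [|i].
    suff -> : (\sum_(i < k) p (zexpg (s i) (e i)) = \sum_i p (s i) *~ e i)%R by [].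
    by apply: eq_bigr => i _; rewrite (additive_onZ sA pA).
  exact: subgroupZ.
split=> [|x y [Ax [e /(pE _ _ Ax) xe]] [Ay [f /(pE _ _ Ay) yf]]].
  split; first exact: subgroup1.
  exists (fun=> 0%R); rewrite big1 // mulg1; exact: (subgroupV sB (subgroup1 sB)).
have AVy := subgroupV sA Ay; split; first exact: subgroupM.
exists (fun i => e i - f i)%R; apply/pE; first exact: subgroupM.
rewrite pA // (additive_onV sA pA) // xe yf -sumrB.
by apply: eq_bigr => i _; rewrite mulrzBr.
Qed.

(** The products of powers of the commutators form a subgroup modulo the next
   term, so commutator identities allow one to replace both entries of a
   commutator by generators. *)
Lemma simple_commutators_generate N Y k : N = generated [set` Y] ->
  generated_modulo_seq (lower_central N k.+1) (lower_central N k.+2)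
    (simple_commutators Y k).
Proof.
move=> NE; have sN : is_subgroup N by rewrite NE; apply: generated_subgroup.
have YN y : y \in Y -> N y by rewrite NE => yY; apply: sub_generated.
pose S j := simple_commutators Y j.
have SN j x : x \in S j -> lower_central N j.+1 x.
  elim: j x => [x /YN //|j IH x /allpairsP[[u y] /= [/IH uj /YN yY ->]]].
  exact: lower_central_comm.
have SN' j (i : 'I_(size (S j))) : lower_central N j.+1 (nth 1 (S j) i).
  by apply: SN; rewrite mem_nth.
split; first exact: SN'.
pose Z j : set G := [set x | lower_central N j.+1 x /\ exists e : 'I_(size (S j)) -> int,
    lower_central N j.+2 (x^-1 * \prod_(i < size (S j)) zexpg (nth 1 (S j) i) (e i))].
have sZ j : is_subgroup (Z j).
  exact: (span_subgroup (lower_central_section j sN) (SN' j)).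
have SZ j x : x \in S j -> Z j x.
  move=> xS; split; first exact: SN.
  have xi : (index x (S j) < size (S j))%N by rewrite index_mem.
  exists (fun i => (i == Ordinal xi)%:R)%R.
  rewrite (big_only1 (Ordinal xi)) => [|//|i /negPf -> //].
  rewrite eqxx /= expg1 nth_index // mulVg.
  exact: (subgroup1 (lower_central_subgroup _ sN)).
have BZ j x : lower_central N j.+2 x -> Z j x.
  move=> jx; split; first exact: lower_central_sub.
  exists (fun=> 0%R); rewrite big1 // mulg1.
  exact: (subgroupV (lower_central_subgroup _ sN)).
have JZ j x g : Z j x -> N g -> Z j (x ^ g).
  move=> Zx Ng; rewrite -[x ^ g](mulVKg x); apply: (subgroupM (sZ j)) => //.
  by apply: BZ; apply: lower_central_comm => //; case: Zx.
suff AZ j : lower_central N j.+1 `<=` Z j by move=> x /AZ[].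
elim: j => [|j IH].
  by rewrite /= {1}NE; apply: generated_sub => // x xY; apply: SZ.
rewrite lower_centralS; apply: generated_sub => // _ [x jx [g Ng <-]].
have sK := lower_central_subgroup j sN.
pose C : set G := [set g | N g /\
  forall x, lower_central N j.+1 x -> Z j.+1 [~ x, g]].
suff /(_ g Ng)[_] : N `<=` C by apply.
have sC : is_subgroup C.
  split=> [|h l [Nh Zh] [Nl Zl]].
    by split=> [|z _]; [exact: subgroup1|rewrite commg1; apply: (subgroup1 (sZ _))].
  have NVl := subgroupV sN Nl.
  split=> [|z jz]; first exact: subgroupM.
  rewrite commgMR commgVR; apply: (subgroupM (sZ _)).
    by apply: (subgroupV (sZ _)); apply: JZ => //; apply: Zl.
  by apply: JZ => //; apply: Zh.
rewrite {1}NE; apply: generated_sub => // y yY; split; first exact: YN.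
have Ny := YN _ yY.
pose D : set G := [set x | lower_central N j.+1 x /\ Z j.+1 [~ x, y]].
have sD : is_subgroup D.
  split=> [|h l [Nh Zh] [Nl Zl]].
    by split; [exact: (subgroup1 sK)|rewrite comm1g; apply: (subgroup1 (sZ _))].
  have NVl : N l^-1 by apply: subgroupV => //; apply: lower_central_subT Nl.
  split; first by apply: (subgroupM sK) => //; apply: (subgroupV sK).
  rewrite commMgR commVgR; apply: (subgroupM (sZ _)); first exact: JZ.
  by apply: (subgroupV (sZ _)); apply: JZ.
have BD z : lower_central N j.+2 z -> D z.
  move=> jz; split; first exact: lower_central_sub.
  by apply: BZ; apply: lower_central_comm.
move=> z jz; have [_ [e ze]] := IH z jz.
suff [] : D z by [].
rewrite -[z]invgK; apply: (subgroupV sD).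
rewrite -(mulgK (\prod_(i < size (S j)) zexpg (nth 1 (S j) i) (e i)) z^-1).
apply: (subgroupM sD); first exact: BD.
apply: (subgroupV sD); apply: subgroup_prod => // i _; apply: (subgroupZ _ sD).
split; first exact: SN'.
by apply: SZ; apply: (allpairs_f (fun x y => [~ x, y])) => //; apply: mem_nth.
Qed.

End SimpleCommutators.

Section NilpotentGrowth.
Local Open Scope group_scope.
Variable G : groupType.
Implicit Types (A B H N P : set G) (x y g : G).

Lemma uniform_bound (T : eqType) (s : seq T) (Q : nat -> T -> Prop) :
  (forall C C' (x : T), (C <= C')%N -> Q C x -> Q C' x) ->
  (forall x : T, x \in s -> exists C, Q C x) ->
  exists C, forall x : T, x \in s -> Q C x.
Proof.
move=> Qle; elim: s => [_|x s IH Qs]; first by exists 0%N.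
have [|C HC] := IH; first by move=> y ys; apply: Qs; rewrite inE ys orbT.
have [C' HC'] := Qs x (mem_head _ _).
exists (maxn C C') => y; rewrite inE => /predU1P[->|/HC].
  by apply: Qle HC'; rewrite leq_maxr.
by apply: Qle; rewrite leq_maxl.
Qed.

Variables (N : set G) (Y : {fset G}) (c : nat) (r : nat -> nat).
Variables (phi : forall k, G -> 'rV[int]_(r k)) (b : forall k, 'I_(r k) -> G).
Hypotheses (NE : N = generated [set` Y]) (Nc : lower_central N c.+1 = [set 1]).
Hypothesis phiP : forall k, (k < c)%N ->
  coordinates (lower_central N k.+1) (lower_central N k.+2) (phi k) (@b k).

Let sN : is_subgroup N. Proof. by rewrite NE; apply: generated_subgroup. Qed.

(** A letter, its weight, and whether it is one of the generators of a quotient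
   of the lower central series, which have powers expressible by the basis
   elements and by letters of larger weight. *)
Let letters_of_weight k : seq (G * nat * bool) :=
  [seq (x, k.+1, true) | x <- simple_commutators Y k] ++
  [seq (b j, k.+1, false) | j <- enum 'I_(r k)].

(** Letters are ordered by weight; within a weight the basis elements come last, as
   the powers of the other generators are expressed by them. *)
Let key (p : G * nat * bool) := (p.1.2 * 2 + ~~ p.2)%N.
Let letters : seq (G * nat * bool) :=
  sort (fun p q => key p <= key q)%N (flatten [seq letters_of_weight k | k <- iota 0 c]).
Let L := size letters.
(* The default letter has weight 1, so that all weights are positive. *)
Let letter0 : G * nat * bool := (1, 1%N, true).
Let t k := (nth letter0 letters k).1.1.
Let w k := (nth letter0 letters k).1.2.
Let fin k := (nth letter0 letters k).2.

Let letters_key i j : (i <= j)%N -> (j < L)%N ->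
  (key (nth letter0 letters i) <= key (nth letter0 letters j))%N.
Proof.
move=> ij jL; apply: (@sorted_leq_nth _ (fun p q => key p <= key q)%N) => //.
- by move=> y x z; apply: leq_trans.
- by apply: sort_sorted => x y; apply: leq_total.
- by rewrite inE; apply: leq_ltn_trans jL.
Qed.

Let simple_commutators_sub k x : x \in simple_commutators Y k ->
  lower_central N k.+1 x.
Proof.
move=> xS; have xi : (index x (simple_commutators Y k) < size (simple_commutators Y k))%N.
  by rewrite index_mem.
have [/(_ (Ordinal xi)) /=] := simple_commutators_generate k NE.
by rewrite nth_index.
Qed.

Let basis_sub k j : (k < c)%N -> lower_central N k.+1 (@b k j).
Proof. by move=> /phiP[_ bA _ _ _]. Qed.

Let letterP a : (a < L)%N -> exists2 k, (k < c)%N &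
  [/\ w a = k.+1, lower_central N k.+1 (t a) &
      fin a -> t a \in simple_commutators Y k].
Proof.
move=> aL; have := mem_nth letter0 aL; rewrite mem_sort => /flatten_mapP[k].
rewrite mem_iota add0n => /andP[_ kc] aS; exists k => //.
rewrite /w /t /fin; move: aS; rewrite mem_cat => /orP[/mapP[x xS ->]|/mapP[j _ ->]] /=.
  by split=> //; apply: simple_commutators_sub.
by split=> //; apply: basis_sub.
Qed.

Let letter_of k p : (k < c)%N -> p \in letters_of_weight k ->
  exists2 a, (a < L)%N & nth letter0 letters a = p.
Proof.
move=> kc pk; have pL : p \in letters.
  by rewrite mem_sort; apply/flatten_mapP; exists k; rewrite // mem_iota.
by exists (index p letters); rewrite ?index_mem // nth_index.
Qed.

Let w_gt0 a : (0 < w a)%N.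
Proof.
have [aL|La] := ltnP a L; first by have [k _ [-> _ _]] := letterP aL.
by rewrite /w nth_default.
Qed.

Let W j C := word_set t (word_bound L w 0 j C 1).

(** By downward induction on the weight, starting from the trivial term of the
   series. *)
Let word_set_weight j x : lower_central N j.+1 x -> exists C, W j.+1 C x.
Proof.
have WE j' C x' : W j' C x' = word_set t (word_bound L w 0 j' C 1) x' by [].
have WM j' x' y' : (exists C, W j' C x') -> (exists C, W j' C y') ->
    exists C, W j' C (x' * y').
  move=> [C xC] [C' yC']; exists (C + C')%N.
  apply: word_set_le (word_setM xC yC') => k.
  by rewrite /word_bound; case: ifP => //; rewrite mulnDl.
have WZ j' x' z : (exists C, W j' C x') -> exists C, W j' C (zexpg x' z).
  move=> [C xC]; exists (`|z| * C)%N; rewrite WE.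
  by apply: word_set_le (word_setZ z xC) => k; rewrite word_bound_scale.
have W1 j' : exists C, W j' C 1 by exists 0%N; apply: word_set1.
have [|cj] := ltnP j c; last first.
  move=> /(lower_central_le sN cj); rewrite Nc => ->; exact: W1.
move: j x; suff H i j x : (c - i <= j)%N -> (j < c)%N -> lower_central N j.+1 x ->
    exists C, W j.+1 C x.
  by move=> j x jc jx; apply: (H c) => //; rewrite subnn.
elim: i j x => [|i IH] j x ij jc jx; first by move: ij; rewrite subn0 leqNgt jc.
have IH' z : lower_central N j.+2 z -> exists C, W j.+1 C z.
  move=> jz; have [C zC] : exists C, W j.+2 C z.
    have [jc'|cj] := ltnP j.+1 c; first by apply: IH => //; lia.
    by move: (lower_central_le sN cj jz); rewrite Nc => ->; apply: W1.
  by exists C; apply: word_set_le zC => k; apply: word_bound_le.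
have [_ /(_ x jx)[e xe]] := simple_commutators_generate j NE.
have WS s : s \in simple_commutators Y j -> exists C, W j.+1 C s.
  move=> sS; have [a aL aE] : exists2 a, (a < L)%N & nth letter0 letters a = (s, j.+1, true).
    by apply: (letter_of jc); rewrite mem_cat map_f.
  exists 1%N; rewrite (_ : s = letter t (a, true)); last by rewrite /letter /= /t aE.
  by apply: word_set_letter; rewrite /word_bound /= aL /w aE /= leqnn exp1n.
have := subgroupV (lower_central_subgroup j.+1 sN) xe; rewrite invgM invgK.
move=> /IH'; set y := \prod_(i < _) _ => yx.
rewrite -[x](mulVKg y); apply: (WM) => //.
rewrite /y; elim/big_ind: _ => //; first exact: (WM).
by move=> l _; apply: WZ; apply: WS; apply: mem_nth.
Qed.

Let word_set_after a j C x : (a < L)%N -> (w a < j)%N -> W j C x ->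
  word_set t (word_bound L w a.+1 j C 1) x.
Proof.
move=> aL aj; apply: word_set_le => k; rewrite /word_bound.
case: ifP => // /and3P[_ kL jk]; rewrite ifT // kL jk !andbT ltnNge.
apply/negP => /letters_key/(_ aL); rewrite /key -/(w k) -/(w a).
by case: (_.2) => /=; case: (_.2) => /=; lia.
Qed.

Let letterR_exists : exists M, forall p q : nat * bool, (q.1 < p.1)%N -> (p.1 < L)%N ->
  word_set t (word_bound L w p.1.+1 (w q.1 + w p.1) M 1) [~ letter t p, letter t q].
Proof.
pose s := [seq (k, e) | k <- iota 0 L, e <- [:: true; false]].
pose Q C (pq : (nat * bool) * (nat * bool)) := let: (p, q) := pq in
  (q.1 < p.1)%N -> (p.1 < L)%N ->
  word_set t (word_bound L w p.1.+1 (w q.1 + w p.1) C 1) [~ letter t p, letter t q].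
have [||M HM] := @uniform_bound _ [seq (p, q) | p <- s, q <- s] Q.
- move=> C C' [p q] CC pqC qp pL; apply: word_set_le (pqC qp pL) => k.
  exact: word_bound_le.
- move=> [p q] _; rewrite /Q.
  have [pL|Lp] := ltnP p.1 L; last by exists 0%N.
  have [qp|pq] := ltnP q.1 p.1; last by exists 0%N.
  have qL : (q.1 < L)%N by apply: ltn_trans pL.
  have [k kc [wp tp _]] := letterP pL; have [l lc [wq tq _]] := letterP qL.
  have letterN m u : lower_central N m.+1 (t u.1) -> lower_central N m.+1 (letter t u).
    rewrite /letter; case: (u.2) => // tu.
    exact: (subgroupV (lower_central_subgroup m sN)).
  have := lower_central_comm2 sN (letterN _ _ tp) (letterN _ _ tq).
  move=> /word_set_weight[C HC]; exists C => _ _.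
  rewrite wp wq (_ : (l.+1 + k.+1)%N = (k + l).+2); last by lia.
  by apply: word_set_after => //; rewrite wp; lia.
exists M => p q qp pL; apply: (HM (p, q)) => //.
have sP u : (u.1 < L)%N -> u \in s.
  move=> uL; apply/allpairsP; exists u; rewrite mem_iota add0n uL.
  by case: (u) => ? []; rewrite !inE.
by apply: allpairs_f; apply: sP => //; apply: ltn_trans pL.
Qed.

Let fin_exists : exists M, forall a, (a < L)%N -> fin a ->
  exists2 m, (0 < m)%N & word_set t (word_bound L w a.+1 (w a) M 1) (t a ^+ m).
Proof.
pose Q C a := (a < L)%N -> fin a ->
  exists2 m, (0 < m)%N & word_set t (word_bound L w a.+1 (w a) C 1) (t a ^+ m).
have [||M HM] := @uniform_bound _ (iota 0 L) Q.
- move=> C C' a CC aC aL fa; have [m m0 am] := aC aL fa; exists m => //.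
  by apply: word_set_le am => k; apply: word_bound_le.
- move=> a; rewrite mem_iota add0n => /andP[_ aL].
  have [k kc [wa ta _]] := letterP aL.
  have [phiA bA phib phi0 _] := phiP kc.
  have sK := lower_central_subgroup k sN.
  pose y := \prod_(j < r k) zexpg (@b k j) (phi k (t a) 0%R j).
  have Ky : lower_central N k.+1 y.
    by apply: subgroup_prod => // j _; apply: subgroupZ.
  have yphi : phi k y = phi k (t a).
    rewrite (additive_on_prod sK phiA) => [|j]; last exact: (subgroupZ _ sK).
    rewrite [RHS]row_sum_delta; apply: eq_bigr => j _.
    by rewrite (additive_onZ sK phiA) // phib -scaler_int intz.
  have := (additive_on_eq sK phiA Ky ta).1 yphi.
  have Kyt : lower_central N k.+1 (y^-1 * t a).
    by apply: (subgroupM sK) => //; apply: (subgroupV sK).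
  move=> /(phi0 _ Kyt)[m m0 mB].
  have [V [p [pA pB _]]] := section_quotient (lower_central_section k sN).
  pose ym := \prod_(j < r k) zexpg (@b k j) (phi k (t a) 0%R j *+ m)%R.
  have Kym : lower_central N k.+1 ym.
    by apply: subgroup_prod => // j _; apply: subgroupZ.
  have Ktm : lower_central N k.+1 (t a ^+ m) by apply: (subgroupX m sK).
  have : lower_central N k.+2 (ym^-1 * t a ^+ m).
    apply/pB; first by apply: (subgroupM sK) => //; apply: (subgroupV sK).
    apply/(additive_on_eq sK pA Kym Ktm).
    move: mB; rewrite -(pB _ (subgroupX m sK Kyt)) (additive_onX sK pA) //.
    rewrite pA ?(additive_onV sK pA) //; last exact: (subgroupV sK).
    rewrite mulrnDl mulNrn addrC (additive_onX sK pA) // => /subr0_eq ->.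
    rewrite !(additive_on_prod sK pA) => [|j|j]; try exact: (subgroupZ _ sK).
    rewrite -sumrMnl; apply: eq_bigr => j _.
    by rewrite !(additive_onZ sK pA) // -mulr_natr natz mulrzA.
  move=> /word_set_weight[C HC].
  exists ((\sum_(j < r k) `|(phi k (t a) 0%R j *+ m)%R|) + C)%N => _ fa; exists m => //.
  rewrite -[t a ^+ m](mulVKg ym).
  apply: (@word_set_le _ _ (fun l =>
    word_bound L w a.+1 (w a) (\sum_(j < r k) `|(phi k (t a) 0%R j *+ m)%R|) 1 l +
    word_bound L w a.+1 (w a) C 1 l)%N) => [l|].
    by rewrite /word_bound; case: ifP => //; rewrite mulnDl.
  apply: word_setM; last first.
    have := word_set_after aL (_ : (w a < k.+2)%N) HC.
    rewrite wa ltnSn => /(_ isT); apply: word_set_le => l.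
    by apply: word_bound_le.
  rewrite /ym; elim/big_ind2: _ => [|x1 n1 x2 n2 h1 h2|j _].
  - exact: word_set1.
  - apply: word_set_le (word_setM h1 h2) => l.
    by rewrite /word_bound; case: ifP => //; rewrite mulnDl.
  have [i iL iE] : exists2 i, (i < L)%N & nth letter0 letters i = (@b k j, k.+1, false).
    apply: (letter_of kc); rewrite mem_cat; apply/orP; right.
    by apply: (map_f (fun j => (@b k j, k.+1, false))); rewrite mem_enum.
  have bi : @b k j = letter t (i, true) by rewrite /letter /= /t iE.
  apply: (@word_set_le _ _ (fun l => `|(phi k (t a) 0%R j *+ m)%R| *
    word_bound L w a.+1 (w a) 1 1 l)%N) => [l|]; first by rewrite word_bound_scale muln1.
  have wi : w i = k.+1 by rewrite /w iE.
  have ai : (a < i)%N.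
    rewrite ltnNge; apply/negP => ia; have := letters_key ia aL.
    by rewrite iE /key -/(w a) -/(fin a) wa fa /=; lia.
  apply: word_setZ; rewrite bi; apply: word_set_letter.
  by rewrite /word_bound [(i, true).1]/= ai iL wi wa leqnn /= exp1n.
exists M => a aL fa; apply: (HM a) => //.
by rewrite mem_iota.
Qed.

Lemma nilpotent_ball_covered : exists C, forall n, (0 < n)%N ->
  covered (C * n ^ \sum_(k < c) k.+1 * r k) (word_ball Y n).
Proof.
have [M HM] := letterR_exists; have [M' HM'] := fin_exists.
have [||C HC] := @weighted_growth G L t w w_gt0 (M + M') _ fin _.
- move=> p q qp pL; apply: word_set_le (HM p q qp pL) => k.
  by apply: word_bound_le => //; rewrite leq_addr.
- move=> a aL fa; have [m m0 am] := HM' a aL fa; exists m => //.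
  by apply: word_set_le am => k; apply: word_bound_le => //; rewrite leq_addl.
have -> : (\sum_(k < c) k.+1 * r k = \sum_(k < L | ~~ fin k) w k)%N.
  rewrite -(big_mkord (fun k => ~~ fin k) w) /L.
  rewrite -(big_nth letter0 (fun p => ~~ p.2) (fun p => p.1.2)).
  rewrite (perm_big _ (permEl (perm_sort _ _))) /= big_flatten big_map.
  rewrite -[in RHS](subn0 c) -/(index_iota 0 c) big_mkord; apply: eq_bigr => k _.
  rewrite big_cat !big_map /= big_pred0 // add0n.
  by rewrite big_const_seq count_predT -enumT size_enum_ord iter_addn_0.
have [K HK] : exists K, forall x, word_ball Y 1 x -> word_set t (word_bound L w 0 0 K 1) x.
  have [||K HK] := @uniform_bound _ (1 :: Y ++ [seq x^-1 | x <- Y])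
    (fun K x => word_set t (word_bound L w 0 0 K 1) x).
  - by move=> K K' x KK; apply: word_set_le => k; apply: word_bound_le.
  - move=> x xY; have : N x.
      have NY y : y \in Y -> N y by move=> yY; rewrite NE; apply: sub_generated.
      move: xY; rewrite inE mem_cat => /or3P[/eqP->|/NY//|/mapP[y /NY Ny ->]].
        exact: subgroup1.
      exact: subgroupV.
    move=> /(@word_set_weight 0)[K xK]; exists K.
    by apply: word_set_le xK => k; apply: word_bound_le.
  exists K => x /ball1E xY; apply: HK; rewrite inE mem_cat.
  case: xY => [->|->|xY]; rewrite ?eqxx ?orbT //.
  by apply/or3P; constructor 3; apply/mapP; exists x^-1; rewrite ?invgK.
exists (C * K.+1 ^ \sum_(k < L | ~~ fin k) w k)%N => n n0.
have Kn : (0 < K.+1 * n)%N by rewrite muln_gt0.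
have := HC _ Kn; apply: covered_le; first by rewrite expnMn mulnA.
move=> g gn; apply: (@word_set_le _ _ (word_bound L w 0 0 (n * K.+1) 1)) => [k|].
  by apply: leq_trans (word_bound_rescale L w_gt0 _ _ _ _) _; rewrite muln1 mulnC.
elim: n g gn {n0 Kn} => [|n IH] g gn.
  by move: gn => [[|x u] [// _ _ ->]]; rewrite big_nil; apply: word_set1.
move: gn => /ballS[->|[x [h [x1 hn ->]]]]; first exact: word_set1.
apply: word_set_le (word_setM (HK x x1) (IH h hn)) => k.
by rewrite /word_bound; case: ifP => // _; rewrite mulSn mulnDl; lia.
Qed.

End NilpotentGrowth.

(** * Growth from below *)

Lemma section_congM (G : groupType) (A B : set G) (x x' y y' : G) :
    abelian_section A B -> A x -> A x' -> A y -> A y' ->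
  B (x^-1 * x')%g -> B (y^-1 * y')%g -> B ((x * y)^-1 * (x' * y'))%g.
Proof.
move=> AB Ax Ax' Ay Ay'; have [V [p [pA pB _]]] := section_quotient AB.
have [sA _ _ _] := AB; have AVM u v : A u -> A v -> A (u^-1 * v)%g.
  by move=> Au Av; apply: (subgroupM sA) => //; apply: (subgroupV sA).
have pE u v : A u -> A v -> B (u^-1 * v)%g <-> p u = p v.
  by move=> Au Av; rewrite -pB; [rewrite -(additive_on_eq sA pA)|apply: AVM].
move=> /pE - /(_ Ax Ax') xx /pE - /(_ Ay Ay') yy.
by apply/pE; rewrite ?pA ?xx ?yy //; apply: (subgroupM sA).
Qed.

Section LowerBound.
Local Open Scope group_scope.
Variables (G : groupType) (K : set G) (Y X : {fset G}) (l : nat).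
Hypothesis KE : K = generated [set` Y].
Hypothesis YX : forall y, y \in Y -> word_ball X l y.
Implicit Types (x y g u : G).

Let sK : is_subgroup K. Proof. by rewrite KE; apply: generated_subgroup. Qed.
Let YK y : y \in Y -> K y. Proof. by move=> yY; rewrite KE; apply: sub_generated. Qed.
Let sG k := lower_central_subgroup k sK.

Lemma simple_commutators_lower_central k x :
  x \in simple_commutators Y k -> lower_central K k.+1 x.
Proof.
elim: k x => [x /YK //|k IH x /allpairsP[[u y] /= [/IH uk /YK yY ->]]].
exact: lower_central_comm.
Qed.

(** Modulo the next term of the lower central series the commutator is
   bimultiplicative. *)
Lemma lower_central_commX k E x y A b : lower_central K k.+1 E ->
  lower_central K k.+1 x -> K y -> lower_central K k.+2 (E^-1 * x ^+ A) ->
  lower_central K k.+3 ([~ E, y ^+ b]^-1 * [~ x, y] ^+ (A * b)).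
Proof.
move=> Ek xk Ky Ex.
have [V [p [pA pB _]]] := section_quotient (lower_central_section k.+1 sK).
have pJ z h : lower_central K k.+2 z -> K h -> p (z ^ h) = p z.
  move=> kz Kh; apply/esym/(additive_on_eq (sG k.+1) pA kz).
    exact: lower_centralJ.
  apply/pB; last exact: lower_central_comm.
  by apply: (subgroupM (sG k.+1)); [exact: (subgroupV (sG k.+1))|exact: lower_centralJ].
have kK z : lower_central K k.+1 z -> K z by apply: lower_central_subT.
have add_l g : K g -> additive_on (lower_central K k.+1) (fun z => p [~ z, g]).
  move=> Kg z z' kz kz'; rewrite commMgR pA ?pJ //; try exact: lower_central_comm.
    exact: kK.
  by apply: lower_centralJ; [|exact: lower_central_comm|exact: kK].
have add_r z : lower_central K k.+1 z -> additive_on K (fun g => p [~ z, g]).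
  move=> kz g g' Kg Kg'; rewrite commgMR pA ?pJ //; try exact: lower_central_comm.
    by rewrite addrC.
  by apply: lower_centralJ => //; exact: lower_central_comm.
have Kyb := subgroupX b sK Ky.
have kxA := subgroupX A (sG k) xk.
have c1 : lower_central K k.+2 [~ E, y ^+ b] by apply: lower_central_comm.
have c2 : lower_central K k.+2 ([~ x, y] ^+ (A * b)).
  by apply: (subgroupX _ (sG k.+1)); apply: lower_central_comm.
apply/pB; first by apply: (subgroupM (sG k.+1)) => //; apply: (subgroupV (sG k.+1)).
apply/(additive_on_eq (sG k.+1) pA c1 c2).
rewrite (additive_onX (sG k.+1) pA); last exact: lower_central_comm.
transitivity (p [~ x ^+ A, y ^+ b]).
  apply/(additive_on_eq (sG k) (add_l _ Kyb) Ek kxA).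
  by apply/pB; apply: lower_central_comm => //; apply: lower_central_sub.
rewrite (additive_onX (sG k) (add_l _ Kyb)) //.
by rewrite (additive_onX sK (add_r _ xk)) // -mulrnA mulnC.
Qed.

Lemma commutator_power_small k x a : x \in simple_commutators Y k ->
  exists E, [/\ lower_central K k.+1 E, lower_central K k.+2 (E^-1 * x ^+ a) &
    word_ball X (l * (2 ^ k * a + 2 ^ k.+1 - 2)) E].
Proof.
elim: k x => [|k IH] x xY.
  exists (x ^+ a); split; first by apply: (subgroupX _ sK); apply: YK.
    by rewrite mulVg; apply: (subgroup1 (sG 1)).
  by rewrite mul1n expn1 addnK mulnC; apply: ballX; apply: YX.
have xk := simple_commutators_lower_central xY.
move: xY xk => /allpairsP[[u y] /= [uS yY ->]] xk.
have [E [kE Eu El]] := IH u uS; have uk := simple_commutators_lower_central uS.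
exists [~ E, y]; split; first by apply: lower_central_comm => //; apply: YK.
  by have := lower_central_commX 1 kE uk (YK yY) Eu; rewrite expg1 muln1.
apply: ball_le (ballR El (YX yY)).
rewrite !mulnA ![(2 * l)%N]mulnC -!mulnA -mulnDr leq_mul2l; apply/orP; right.
have k2 : (0 < 2 ^ k)%N by rewrite expn_gt0.
by rewrite !expnS; nia.
Qed.

(** A power of a commutator of weight [k.+1] with exponent up to [q ^ k.+1] is
   expressed with length linear in [q] by writing the exponent in base [q] and
   distributing the factors [q] over the entries. *)
Lemma commutator_power k x q A : (0 < q)%N -> x \in simple_commutators Y k ->
    (A < q ^ k.+1)%N ->
  exists E, [/\ lower_central K k.+1 E, lower_central K k.+2 (E^-1 * x ^+ A) &
    word_ball X (l * ((2 * k + 1) * 2 ^ k * q)) E].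
Proof.
move=> q0; elim: k x A => [|k IH] x A xY Aq.
  rewrite expn1 in Aq; exists (x ^+ A); split.
  - by apply: (subgroupX _ sK); apply: YK.
  - by rewrite mulVg; apply: (subgroup1 (sG 1)).
  - apply: ball_le (ballX A (YX xY)).
    by rewrite !mul1n mulnC leq_mul2l (ltnW Aq) orbT.
have xk := simple_commutators_lower_central xY.
have [F [kF Fx Fl]] := commutator_power_small (A %% q) xY.
move: xY xk Fx => /allpairsP[[u y] /= [uS yY ->]] xk Fx.
have [|E [kE Eu El]] := IH u (A %/ q)%N uS; first by rewrite ltn_divLR // -expnSr.
have uk := simple_commutators_lower_central uS.
exists ([~ E, y ^+ q] * F); split.
- apply: (subgroupM (sG k.+1)) => //; apply: lower_central_comm => //.
  by apply: (subgroupX _ sK); apply: YK.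
- have Euq := lower_central_commX q kE uk (YK yY) Eu.
  rewrite [X in _ * _ ^+ X](divn_eq A q) expgnDr.
  have ek := lower_central_comm kE (subgroupX q sK (YK yY)).
  by apply: (section_congM (lower_central_section k.+1 sK)) => //;
    apply: (subgroupX _ (sG k.+1)).
- have zl := ballR El (ballX q (YX yY)).
  apply: ball_le (ballM zl Fl).
  have rq : (A %% q < q)%N by rewrite ltn_mod.
  have -> : (2 * (l * ((2 * k + 1) * 2 ^ k * q)) + 2 * (q * l) =
    l * (2 * ((2 * k + 1) * 2 ^ k * q) + 2 * q))%N by ring.
  rewrite -mulnDr leq_mul2l; apply/orP; right.
  have k2 : (0 < 2 ^ k)%N by rewrite expn_gt0.
  by rewrite !expnS; nia.
Qed.

Variables (c : nat) (r : nat -> nat).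
Variables (phi : forall k, G -> 'rV[int]_(r k)) (b : forall k, 'I_(r k) -> G).
Hypothesis phiP : forall k, (k < c)%N ->
  coordinates (lower_central K k.+1) (lower_central K k.+2) (phi k) (@b k).

(** Independence of the commutators separates the cosets, and the lengths of
   [commutator_power] add up over the [r k] factors. *)
Lemma growth_layer k q : (0 < q)%N -> (k < c)%N ->
  exists e : {ffun 'I_(r k) -> 'I_(q ^ k.+1)} -> G,
    [/\ forall A, lower_central K k.+1 (e A),
        forall A A', lower_central K k.+2 ((e A)^-1 * e A') -> A = A' &
        forall A, word_ball X (l * (r k * ((2 * k + 1) * 2 ^ k) * q)) (e A)].
Proof.
move=> q0 kc; have gen := simple_commutators_generate k KE.
have kS := lower_central_section k sK.
have [f [xK xind]] := independent_generators kS (phiP kc) gen.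
set x : 'I_(r k) -> G := _ \o f in xK xind.
have xS j : x j \in simple_commutators Y k by apply: mem_nth.
have /choice[E HE] : forall jA : 'I_(r k) * 'I_(q ^ k.+1), exists E,
    [/\ lower_central K k.+1 E, lower_central K k.+2 (E^-1 * x jA.1 ^+ jA.2) &
        word_ball X (l * ((2 * k + 1) * 2 ^ k * q)) E].
  by move=> [j A]; apply: commutator_power.
have kE j A : lower_central K k.+1 (E (j, A)) by case: (HE (j, A)).
exists (fun A => \prod_(j < r k) E (j, A j)); split=> [A|A A' AA|A].
- by apply: subgroup_prod.
- have [V [p [pA pB _]]] := section_quotient kS.
  have pE (B : {ffun 'I_(r k) -> 'I_(q ^ k.+1)}) :
      p (\prod_(j < r k) E (j, B j)) = (\sum_j p (x j) *+ B j)%R.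
    rewrite (additive_on_prod (sG k) pA) //; apply: eq_bigr => j _.
    have [_ /= Ex _] := HE (j, B j).
    rewrite -(additive_onX (sG k) pA) //.
    apply/(additive_on_eq (sG k) pA) => //; first exact: (subgroupX _ (sG k)).
    apply/pB => //; apply: (subgroupM (sG k)); first exact: (subgroupV (sG k)).
    exact: (subgroupX _ (sG k)).
  have kP (B : {ffun 'I_(r k) -> 'I_(q ^ k.+1)}) :
    lower_central K k.+1 (\prod_(j < r k) E (j, B j)) by apply: subgroup_prod.
  have : p (\prod_(j < r k) E (j, A j)) = p (\prod_(j < r k) E (j, A' j)).
    apply/(additive_on_eq (sG k) pA) => //; apply/pB => //.
    by apply: (subgroupM (sG k)) => //; apply: (subgroupV (sG k)).
  rewrite !pE => /eqP; rewrite -subr_eq0 -sumrB => /eqP AA0.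
  apply/ffunP => j; apply: val_inj; have := xind (fun j => (A j)%:Z - (A' j)%:Z)%R.
  move=> /(_ _ j)/eqP; rewrite subr_eq0 => H; apply/eqP; rewrite -eqz_nat; apply: H.
  apply/pB; first by apply: subgroup_prod => // i _; apply: subgroupZ.
  rewrite (additive_on_prod (sG k) pA) => [|i]; last exact: subgroupZ.
  rewrite -[RHS]AA0; apply: eq_bigr => i _.
  by rewrite (additive_onZ (sG k) pA) // mulrzBr.
- have : forall s : seq 'I_(r k),
      word_ball X (size s * (l * ((2 * k + 1) * 2 ^ k * q))) (\prod_(j <- s) E (j, A j)).
    elim=> [|j s IH]; first by rewrite big_nil; apply: ball1.
    by rewrite big_cons mulSn; apply: ballM => //; case: (HE (j, A j)).
  move=> /(_ (index_enum _)); apply: ball_le.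
  by rewrite [index_enum _]unlock -enumT size_enum_ord; apply: eq_leq; ring.
Qed.

(** A product of elements from the layers of all weights determines its factors, as
   those of larger weight lie in the next term of the series. *)
Lemma growth_lower_bound q : (0 < q)%N ->
  (q ^ (\sum_(k < c) k.+1 * r k) <=
   growth X (l * ((\sum_(k < c) r k * ((2 * k + 1) * 2 ^ k)) * q)))%N.
Proof.
move=> q0.
pose D i := (\sum_(i <= k < c) k.+1 * r k)%N.
pose W i := (\sum_(i <= k < c) r k * ((2 * k + 1) * 2 ^ k))%N.
suff [s [us sb sK0 sz]] : exists s : seq G, [/\ uniq s,
    forall g, g \in s -> word_ball X (l * (W 0%N * q)) g,
    forall g, g \in s -> lower_central K 1 g & size s = q ^ D 0%N]%N.
  have -> : (\sum_(k < c) k.+1 * r k = D 0)%N by rewrite /D big_mkord.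
  rewrite -sz; apply: growth_ge => // g /sb.
  by rewrite /W big_mkord.
suff H i : (i <= c)%N -> exists s : seq G, [/\ uniq s,
    forall g, g \in s -> word_ball X (l * (W (c - i) * q)) g,
    forall g, g \in s -> lower_central K (c - i).+1 g & size s = q ^ D (c - i)]%N.
  by have := H c (leqnn c); rewrite subnn.
elim: i => [_|i IH ic].
  exists [:: 1]; rewrite subn0 /D /W !big_geq //; split=> //.
    by move=> g; rewrite inE => /eqP ->; apply: ball1.
  by move=> g; rewrite inE => /eqP ->; apply: (subgroup1 (sG c)).
have [|s [us sb sk sz]] := IH; first exact: ltnW.
have kc : (c - i.+1 < c)%N by lia.
have kE : (c - i = (c - i.+1).+1)%N by lia.
rewrite kE in sb sk sz; move: (c - i.+1)%N kc {kE} sb sk sz => k kc sb sk sz.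
have [e [ek e_inj eb]] := growth_layer q0 kc.
exists [seq e A * g | A <- enum {ffun 'I_(r k) -> 'I_(q ^ k.+1)}, g <- s]; split.
- apply: allpairs_uniq; rewrite ?enum_uniq // => -[A g] [A' g'] /=.
  move=> /allpairsP[[A1 g1] /= [_ gs [-> ->]]] /allpairsP[[A2 g2] /= [_ gs' [-> ->]]] eg.
  have AA : A1 = A2.
    apply: e_inj; rewrite (_ : _ * _ = g1 * g2^-1).
      by apply: (subgroupM (sG k.+1)); [|apply: (subgroupV (sG k.+1))]; apply: sk.
    by rewrite -[g1](mulKg (e A1)) eg !gnorm.
  by move: eg; rewrite AA => /mulgI ->.
- move=> _ /allpairsP[[A g] /= [_ gs ->]].
  apply: ball_le (ballM (eb A) (sb g gs)).
  have -> : W k = (r k * ((2 * k + 1) * 2 ^ k) + W k.+1)%N by rewrite /W big_ltn.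
  by apply: eq_leq; ring.
- move=> _ /allpairsP[[A g] /= [_ gs ->]].
  apply: (subgroupM (sG k)) => //.
  by apply: lower_central_sub => //; apply: sk.
- rewrite size_allpairs -cardE card_ffun !card_ord sz -expnM -expnD.
  by rewrite /D [in RHS]big_ltn.
Qed.

End LowerBound.

(** * Subgroups of finite index *)

Section FiniteIndex.
Local Open Scope group_scope.
Variable G : groupType.
Implicit Types (A B C H N P : set G) (x y g : G).

Lemma finite_index_in_setT H : is_subgroup H -> finite_index H ->
  finite_index_in [set: G] H.
Proof.
move=> sH; rewrite /finite_index; set S := [set _ | _ in _] => finS.
have Sg g : [set g * h | h in H] \in fset_set S.
  by rewrite in_fset_set // inE; exists g.
exists (fset_set S), (fun g => [` Sg g]%fset) => x y _ _ /(congr1 val) /= xy.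
have : [set y * h | h in H] y by exists 1; rewrite ?mulg1 //; apply: subgroup1.
by rewrite -xy => -[h Hh <-]; rewrite mulKg.
Qed.

Lemma finite_index_in_trans A B C : finite_index_in A B -> finite_index_in B C ->
  finite_index_in A C.
Proof.
move=> [F [f fP]] [F' [f' fP']].
pose rep u := xget 1 [set x | A x /\ f x = u].
have repP x : A x -> A (rep (f x)) /\ f (rep (f x)) = f x.
  by move=> Ax; apply: (xgetPex 1 (P := [set y | A y /\ f y = f x])); exists x.
exists (F * F')%type, (fun x => (f x, f' ((rep (f x))^-1 * x))).
move=> x y Ax Ay [fxy]; have [Ax' xr] := repP x Ax.
have Bx : B ((rep (f x))^-1 * x) by apply: fP.
have By : B ((rep (f x))^-1 * y) by apply: fP => //; rewrite xr.
by rewrite -fxy => /(fP' _ _ Bx By); rewrite !gnorm.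
Qed.

Lemma finite_index_in_sub A A' B B' : A' `<=` A -> B `<=` B' ->
  finite_index_in A B -> finite_index_in A' B'.
Proof.
by move=> AA BB [F [f fP]]; exists F, f => x y /AA Ax /AA Ay /(fP _ _ Ax Ay)/BB.
Qed.

Lemma finite_index_in_cap A B C : is_subgroup C -> finite_index_in A B ->
  finite_index_in (A `&` C) (B `&` C).
Proof.
move=> sC [F [f fP]]; exists F, f => x y [Ax Cx] [Ay Cy] xy; split; first exact: fP.
by apply: (subgroupM sC) => //; apply: (subgroupV sC).
Qed.

(** Compose [f] with the choice of a representative in each coset. *)
Lemma finite_index_cosets A B : is_subgroup A -> is_subgroup B -> B `<=` A ->
    finite_index_in A B ->
  exists (F : finType) (f : G -> F),
    forall x y, A x -> A y -> (f x = f y <-> B (x^-1 * y)).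
Proof.
move=> sA sB BA [F [f fP]].
pose c x := xget 1 [set y | A y /\ B (x^-1 * y)].
have cP x : A x -> A (c x) /\ B (x^-1 * c x).
  move=> Ax; apply: (xgetPex 1 (P := [set y | A y /\ B (x^-1 * y)])).
  by exists x; split=> //; rewrite mulVg; apply: subgroup1.
exists F, (f \o c) => x y Ax Ay /=.
have [[Acx Bx] [Acy By]] := (cP x Ax, cP y Ay); split=> [/(fP _ _ Acx Acy) Bxy|Bxy].
  rewrite (_ : x^-1 * y = (x^-1 * c x) * ((c x)^-1 * c y) * (y^-1 * c y)^-1).
    by apply: (subgroupM sB); [apply: (subgroupM sB)|apply: (subgroupV sB)].
  by rewrite !gnorm.
congr (f (xget _ _)); apply/seteqP; split=> z [Az Bz]; split=> //.
  rewrite (_ : y^-1 * z = (x^-1 * y)^-1 * (x^-1 * z)); last by rewrite !gnorm.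
  by apply: (subgroupM sB) => //; apply: (subgroupV sB).
rewrite (_ : x^-1 * z = (x^-1 * y) * (y^-1 * z)); last by rewrite !gnorm.
exact: (subgroupM sB).
Qed.

(** An element acts on the finite set of cosets of [H] by left translation, and two
   elements acting in the same way differ by an element of the core. *)
Lemma normal_core H : is_subgroup H -> finite_index_in [set: G] H ->
  exists N, [/\ is_subgroup N, N `<=` H, normal_in N [set: G] &
                finite_index_in [set: G] N].
Proof.
move=> sH [F [f fP]]; pose N := [set x | forall g, H (x ^ g)].
pose rep u := xget 1 [set x | f x = u].
have repP x : f (rep (f x)) = f x.
  by apply: (xgetPex 1 (P := [set y | f y = f x])); exists x.
exists N; split.
- split=> [g|x y Nx Ny g]; first by rewrite conj1g; apply: subgroup1.
  by rewrite conjMg conjVg; apply: (subgroupM sH) => //; apply: (subgroupV sH).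
- by move=> x /(_ 1); rewrite conjg1.
- by move=> g _ x Nx h; rewrite -conjgM.
exists {ffun F -> F}, (fun x => [ffun u => f (x * rep u)]) => x y _ _ xy g.
have /(fP _ _ I I) H1 : f (x * rep (f g)) = f (y * rep (f g)).
  by have := congr1 (fun h : {ffun F -> F} => h (f g)) xy; rewrite !ffunE.
have /(fP _ _ I I) H2 : f (rep (f g)) = f g by [].
rewrite (_ : _ ^ g = ((x * rep (f g))^-1 * (y * rep (f g))) ^ ((rep (f g))^-1 * g)).
  by apply: subgroupJ.
by rewrite /conjg !gnorm.
Qed.

Lemma exponent_of_finite_index A B x : is_subgroup A -> is_subgroup B ->
  finite_index_in A B -> A x -> exists2 m, (0 < m)%N & B (x ^+ m).
Proof.
move=> sA sB [F [f fP]] Ax.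
have /injectivePn[i [j ij fij]] : ~~ injectiveb (fun i : 'I_#|F|.+1 => f (x ^+ i)).
  by apply/negP => /injectiveP/leq_card; rewrite card_ord ltnn.
wlog lt_ij : i j ij fij / (i < j)%N.
  move=> H; case: (ltngtP i j) => [|ji|/val_inj ji]; first exact: H.
    by apply: (H j i) => //; rewrite eq_sym.
  by rewrite ji eqxx in ij.
exists (j - i)%N; first by rewrite subn_gt0.
have := fP _ _ (subgroupX i sA Ax) (subgroupX j sA Ax) fij.
by rewrite -{1}(subnKC (ltnW lt_ij)) expgnDr mulKg.
Qed.

Variable X : {fset G}.
Hypothesis XG : generates X.

Lemma generates_ball g : exists n, word_ball X n g.
Proof. by apply: generated_ball; rewrite [generated _]XG. Qed.

(** The number of cosets met by balls increases strictly until all are met. *)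
Lemma short_representatives (F : finType) (f : G -> F) m :
    (forall x y z, f x = f y -> f (z * x) = f (z * y)) ->
    (#|[set u | `[< exists g, f g = u >]]%SET| <= m)%N -> (0 < m)%N ->
  forall g, exists2 h, word_ball X m.-1 h & f h = f g.
Proof.
move=> fM mF m0; pose S n : {set F} := finset (fun u => `[< exists2 h, word_ball X n h & f h = u >]).
have inS n u : u \in S n <-> exists2 h, word_ball X n h & f h = u.
  by rewrite inE; split=> [/asboolP//|?]; apply/asboolP.
have S_le n n' : (n <= n')%N -> S n \subset S n'.
  move=> nn; apply/fintype.subsetP => u /inS[h hn <-]; apply/inS; exists h => //.
  exact: ball_le hn.
have stable n n' : S n = S n.+1 -> S n' \subset S n.
  move=> SE; elim: n' => [|n' IH]; first exact: S_le.
  apply/fintype.subsetP => u /inS[_ /ballS[->|[x [h [x1 hn' ->]]]] <-].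
    by apply/inS; exists 1; first exact: ball1.
  have /inS[h' h'n fh] : f h \in S n.
    by apply: (fintype.subsetP IH); apply/inS; exists h.
  rewrite -(fM _ _ x fh) SE; apply/inS.
  by exists (x * h') => //; apply: ballM x1 h'n.
have dich j : (exists2 i, (i < j)%N & S i = S i.+1) \/ (j < #|S j|)%N.
  elim: j => [|j [[i ij SE]|jS]].
  - right; apply/card_gt0P; exists (f 1); apply/inS; exists 1 => //; exact: ball1.
  - by left; exists i => //; apply: ltnW.
  - have [SE|SE] := eqVneq (S j) (S j.+1); first by left; exists j.
    right; apply: leq_ltn_trans jS _; apply: proper_card.
    by rewrite finset.properEneq SE S_le.
have [[i im SE] g|] := dich m; last first.
  rewrite ltnNge => /negP[]; apply: leq_trans mF; apply: subset_leq_card.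
  by apply/fintype.subsetP => u /inS[h _ <-]; rewrite inE; apply/asboolP; exists h.
have [n gn] := generates_ball g.
have /inS[h hi <-] : f g \in S i.
  by apply: (fintype.subsetP (stable i n SE)); apply/inS; exists g.
by exists h => //; apply: ball_le hi; lia.
Qed.

(** The Schreier generators [(rep (x t))^-1 * (x * t)] have length at most
   [2 * m - 1], the representatives having length at most [m - 1]. *)
Lemma schreier N (F : finType) (f : G -> F) m : is_subgroup N ->
    (forall x y, f x = f y <-> N (x^-1 * y)) ->
    (#|[set u | `[< exists g, f g = u >]]%SET| <= m)%N ->
  exists Y : {fset G}, [/\ N = generated [set` Y],
    forall y, y \in Y -> word_ball X (2 * m) y &
    exists T : seq G, forall n g, word_ball X n g ->
      exists t h, [/\ t \in T, word_ball Y n h & g = t * h]].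
Proof.
move=> sN fP mF.
have m0 : (0 < m)%N.
  by apply: leq_trans mF; apply/card_gt0P; exists (f 1); rewrite inE; apply/asboolP; exists 1.
have fM x y z : f x = f y -> f (z * x) = f (z * y).
  by move=> /fP Nxy; apply/fP; rewrite invgM -mulgA mulKg.
pose rep u := if u == f 1 then 1 else xget 1 [set h | word_ball X m.-1 h /\ f h = u].
have repP g : word_ball X m.-1 (rep (f g)) /\ f (rep (f g)) = f g.
  rewrite /rep; case: eqP => [->|_]; first by split=> //; apply: ball1.
  apply: (xgetPex 1 (P := [set h | word_ball X m.-1 h /\ f h = f g])).
  by have [h hm hg] := short_representatives fM mF m0 g; exists h.
have rep1 : rep (f 1) = 1 by rewrite /rep eqxx.
pose D : set F := [set u | exists g, f g = u].
pose S := [set (rep (f (x * t)))^-1 * (x * t) | x in word_ball X 1 & t in rep @` D].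
have finS : finite_set S.
  apply: finite_image2; first exact: finite_ball.
  exact/finite_image/finite_finset.
have SP y : y \in fset_set S <-> exists x g, word_ball X 1 x /\
    y = (rep (f (x * rep (f g))))^-1 * (x * rep (f g)).
  rewrite in_fset_set // inE; split=> [[x x1 [_ [_ [g <-] <-] <-]]|[x [g [x1 ->]]]].
    by exists x, g.
  by exists x => //; exists (rep (f g)) => //; exists (f g) => //; exists g.
have SN y : y \in fset_set S -> N y.
  by move=> /SP[x [g [_ ->]]]; apply/fP; case: (repP (x * rep (f g))).
have ballN n g : word_ball X n g -> word_ball (fset_set S) n ((rep (f g))^-1 * g).
  elim: n g => [|n IH] g.
    by move=> [[|x u] [// _ _ ->]]; rewrite big_nil rep1 mulg1 invg1; apply: ball1.
  move=> /ballS[->|[x [h [x1 hn ->]]]]; first by rewrite rep1 mulg1 invg1; apply: ball1.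
  have xh : f (x * rep (f h)) = f (x * h) by apply: fM; case: (repP h).
  rewrite (_ : _ * _ = ((rep (f (x * h)))^-1 * (x * rep (f h))) * ((rep (f h))^-1 * h)).
    apply: (@ballM _ _ 1); last exact: IH.
    by apply: ball_gen; apply/SP; exists x, h; rewrite xh.
  by rewrite !gnorm.
exists (fset_set S); split.
- apply/seteqP; split=> [g Ng|]; last by apply: generated_sub => // y /SN.
  have [n /ballN] := generates_ball g.
  have -> : f g = f 1 by apply/esym/fP; rewrite invg1 mul1g.
  rewrite rep1 invg1 mul1g; apply: ball_generated; last exact: sub_generated.
  exact: generated_subgroup.
- move=> y /SP[x [g [x1 ->]]].
  have [[r1 _] [r2 _]] := (repP (x * rep (f g)), repP g).
  apply: ball_le (ballM (ballV r1) (ballM x1 r2)); lia.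
exists [seq rep u | u <- enum F] => n g gn.
exists (rep (f g)), ((rep (f g))^-1 * g); split; last by rewrite mulVKg.
  by rewrite map_f // mem_enum.
exact: ballN.
Qed.

End FiniteIndex.

(** * Transfer to subgroups of finite index *)

Section Transfer.
Local Open Scope group_scope.
Variable G : groupType.
Implicit Types (A B C H N P Q : set G) (x y g : G).

(** [T x] sums over representatives [t] of the cosets of [B] the value of [phi] at
   the part of [x * t] in [B]. Left translation permutes the cosets, which makes
   [T] additive. An element of [B] fixes every coset, as [Q] normalizes [B], and
   by invariance of [phi] each coset then contributes [phi x]. *)
Lemma transfer Q B (V : zmodType) (phi : G -> V) : is_subgroup Q -> is_subgroup B ->
    B `<=` Q -> finite_index_in Q B -> additive_on B phi ->
    (forall x g, B x -> Q g -> B (x ^ g) /\ phi (x ^ g) = phi x) ->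
  exists (T : G -> V) (m : nat),
    [/\ (0 < m)%N, additive_on Q T & forall x, B x -> T x = (phi x *+ m)%R].
Proof.
move=> sQ sB BQ /(finite_index_cosets sQ sB BQ)[F [f fP]] phiB phiQ.
pose rep u := xget 1 [set x | Q x /\ f x = u].
have repP x : Q x -> Q (rep (f x)) /\ f (rep (f x)) = f x.
  by move=> Qx; apply: (xgetPex 1 (P := [set y | Q y /\ f y = f x])); exists x.
pose D : {set F} := finset (fun u => `[< exists2 x, Q x & f x = u >]).
have inD u : u \in D <-> exists2 x, Q x & f x = u.
  by rewrite inE; split=> [/asboolP//|?]; apply/asboolP.
have Qrep u : u \in D -> Q (rep u) /\ f (rep u) = u.
  by move=> /inD[x Qx <-]; apply: repP.
have QM x y : Q x -> Q y -> Q (x * y) by exact: subgroupM.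
have Bbeta x : Q x -> B ((rep (f x))^-1 * x) by move=> Qx; apply/fP; case: (repP x Qx).
pose h x := phi ((rep (f x))^-1 * x).
have hM x y : Q x -> B y -> h (x * y) = (h x + phi y)%R.
  move=> Qx By; have -> : h (x * y) = phi ((rep (f x))^-1 * x * y).
    rewrite /h mulgA; congr (phi (_^-1 * _ * _)); congr rep; apply/fP => //.
      by apply: QM => //; apply: BQ.
    by rewrite invgM -mulgA mulVg mulg1; apply: subgroupV.
  by rewrite phiB //; apply: Bbeta.
have h_rep u : u \in D -> h (rep u) = 0%R.
  by move=> /Qrep[_ fu]; rewrite /h fu mulVg (additive_on1 sB phiB).
exists (fun x => (\sum_(u in D) h (x * rep u)%g)%R), #|D|; split.
- by apply/card_gt0P; exists (f 1); apply/inD; exists 1 => //; apply: subgroup1.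
- move=> x y Qx Qy; pose s u := f (y * rep u).
  have s_inj : {in D &, injective s}.
    move=> u v /Qrep[Qu fu] /Qrep[Qv fv] /(fP _ _ (QM _ _ Qy Qu) (QM _ _ Qy Qv)).
    by rewrite invgM -mulgA mulKg => /(fP _ _ Qu Qv); rewrite fu fv.
  have sD : (s @: D)%SET = D.
    apply/eqP; rewrite eqEcard card_in_imset // leqnn andbT.
    apply/fintype.subsetP => _ /imsetP[u /Qrep[Qu _] ->]; apply/inD.
    by exists (y * rep u) => //; apply: QM.
  rewrite -[in X in (_ = X + _)%R]sD big_imset //= -big_split /=.
  apply: eq_bigr => u /Qrep[Qu _]; have Qyu := QM _ _ Qy Qu.
  rewrite -hM; last exact: Bbeta.
    by rewrite /s !mulgA mulgK.
  by apply: QM => //; case: (repP _ Qyu).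
- move=> x Bx; rewrite -sumr_const; apply: eq_bigr => u uD; have [Qu _] := Qrep u uD.
  have [Bxu <-] := phiQ x _ Bx Qu.
  by rewrite conjgC hM // h_rep // add0r.
Qed.

Variables (N P : set G) (c : nat) (r : nat -> nat).
Variables (phi : forall k, G -> 'rV[int]_(r k)) (b : forall k, 'I_(r k) -> G).
Hypotheses (sN : is_subgroup N) (sP : is_subgroup P) (NP : N `<=` P).
Hypotheses (nNP : normal_in N P) (iNP : finite_index_in P N).
Hypothesis phiP : forall k, (k < c)%N ->
  coordinates (lower_central N k.+1) (lower_central N k.+2) (phi k) (@b k).

Lemma rV_int_mulrn_eq0 n (v : 'rV[int]_n) m : (0 < m)%N -> (v *+ m = 0)%R -> v = 0%R.
Proof.
move=> m0 /rowP vm; apply/rowP => j; have := vm j.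
by rewrite mulmxnE !mxE => /eqP; rewrite mulrn_eq0 eqn0Ngt m0 => /eqP.
Qed.

Let lcNJ k x g : P g -> lower_central N k.+1 x -> lower_central N k.+1 (x ^ g).
Proof. by move=> Pg; apply: lower_central_normalizes; apply: nNP. Qed.

Lemma coordinates_conj_eq k x y g : (k < c)%N -> P g ->
  lower_central N k.+1 x -> lower_central N k.+1 y ->
  phi k x = phi k y -> phi k (x ^ g) = phi k (y ^ g).
Proof.
move=> kc Pg xk yk; have sG := lower_central_subgroup k sN.
have [phiA _ _ phi0 _] := phiP kc.
have kxy : lower_central N k.+1 (x^-1 * y).
  by apply: (subgroupM sG) => //; apply: (subgroupV sG).
move=> /(additive_on_eq sG phiA xk yk)/(phi0 _ kxy)[m m0 mB].
apply/(additive_on_eq sG phiA); try exact: lcNJ.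
rewrite -conjVg -conjMg; apply/phi0; first exact: lcNJ.
by exists m => //; rewrite -conjXg; apply: lcNJ.
Qed.

(** The finite group [P / N] acts on Z^r, so that a unipotent element acts
   trivially. *)
Lemma unipotent_coordinates g n k x : P g ->
    (forall z, P z -> iter n (fun z => [~ z, g]) z = 1) ->
    (k < c)%N -> lower_central N k.+1 x ->
  phi k (x ^ g) = phi k x.
Proof.
move=> Pg gn kc xk; have sG := lower_central_subgroup k sN.
have [phiA _ _ phi0 _] := phiP kc; have kS := lower_central_section k sN.
pose delta z := [~ z, g].
have kd z : lower_central N k.+1 z -> lower_central N k.+1 (delta z).
  by move=> kz; apply: (subgroupM sG); [apply: (subgroupV sG)|apply: lcNJ].
have zg z : z ^ g = z * delta z by rewrite /delta /commg mulVKg.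
suff H i z : lower_central N k.+1 z -> phi k (iter i.+1 delta z) = 0%R ->
    phi k (delta z) = 0%R.
  have Pdx : P (delta x) by apply: NP; apply: lower_central_subT (kd _ xk).
  have d0 : phi k (delta x) = 0%R.
    by apply: (H n x xk); rewrite iterSr (gn _ Pdx) (additive_on1 sG phiA).
  by rewrite zg (phiA _ _ xk (kd _ xk)) d0 addr0.
have step z' : lower_central N k.+1 z' -> phi k (delta (delta z')) = 0%R ->
    phi k (delta z') = 0%R.
  move=> kz ddz; have kdz := kd _ kz.
  have Pgi i' : P (g ^+ i') by apply: subgroupX.
  have dzg i' : phi k (delta z' ^ (g ^+ i')) = phi k (delta z').
    elim: i' => [|i' IH]; first by rewrite conjg1.
    rewrite expgS conjgM -[RHS]IH; apply: coordinates_conj_eq => //; first exact: lcNJ.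
    by rewrite zg phiA ?ddz ?addr0 //; apply: kd.
  have zgi i' : phi k (z' ^ (g ^+ i')) = (phi k z' + phi k (delta z') *+ i')%R.
    elim: i' => [|i' IH]; first by rewrite conjg1 addr0.
    by rewrite expgS conjgM zg conjMg phiA ?IH ?dzg ?mulrSr ?addrA //; apply: lcNJ.
  have [m m0 Ngm] := exponent_of_finite_index sP sN iNP Pg.
  apply: (rV_int_mulrn_eq0 m0); apply: (@addrI _ (phi k z')); rewrite -zgi addr0.
  apply/esym/(additive_on_eq sG phiA) => //; first exact: lcNJ.
  by apply: (coordinates_eq0 kS (phiP kc)); apply: lower_central_comm.
elim: i z => [//|i IH] z kz dz; apply: (IH z kz); rewrite iterS.
apply: step; first by elim: (i) => //= j; apply: kd.
by [].
Qed.

Hypothesis phiJ : forall k x g, (k < c)%N -> lower_central N k.+1 x -> P g ->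
  phi k (x ^ g) = phi k x.

Let lcNP k : lower_central N k.+1 `<=` lower_central P k.+1.
Proof. exact: lower_central_mono. Qed.

(** The transfer extends a multiple of [phi k] to a homomorphism on the term
   [lower_central P k.+1]. It is invariant under [P], because a homomorphism to
   Z^r that vanishes on a subgroup of finite index is zero; so it vanishes on
   [lower_central P k.+2], whose elements in [lower_central N k.+1] are therefore
   torsion modulo [lower_central N k.+2]. As the torsion is finite, the index
   stays finite. *)
Lemma lower_central_finite_index_step k : (k < c)%N ->
  finite_index_in (lower_central P k.+1) (lower_central N k.+1) ->
  (forall x, lower_central P k.+2 x -> lower_central N k.+1 x -> phi k x = 0%R) /\
  finite_index_in (lower_central P k.+2) (lower_central N k.+2).
Proof.
move=> kc ik; have [phiA bA phib phi0 phi_fin] := phiP kc.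
have sG := lower_central_subgroup k sN; have sQ := lower_central_subgroup k sP.
have [|T [m [m0 TA Tphi]]] := transfer sQ sG (lcNP (k := k)) ik phiA.
  move=> x g xk gk; have Pg := lower_central_subT sP gk.
  by split; [apply: lcNJ|apply: phiJ].
have T0 x g : lower_central P k.+1 x -> P g -> T [~ x, g] = 0%R.
  move=> xk Pg; pose W z := (T (z ^ g)%g - T z)%R.
  have QJ z : lower_central P k.+1 z -> lower_central P k.+1 (z ^ g).
    by move=> kz; apply: lower_centralJ.
  have WA : additive_on (lower_central P k.+1) W.
    move=> y z ky kz; rewrite /W conjMg (TA _ _ ky kz) (TA _ _ (QJ _ ky) (QJ _ kz)).
    by rewrite opprD addrACA.
  have -> : T [~ x, g] = W x.
    rewrite commgEl (TA _ _ (subgroupV sQ xk) (QJ _ xk)).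
    by rewrite (additive_onV sQ TA) // addrC.
  have [j j0 xj] := exponent_of_finite_index sQ sG ik xk.
  apply: (rV_int_mulrn_eq0 j0); rewrite -(additive_onX sQ WA) // /W.
  by rewrite !Tphi ?phiJ ?subrr //; apply: lcNJ.
have T0' x : lower_central P k.+2 x -> T x = 0%R.
  pose Z := [set x | lower_central P k.+1 x /\ T x = 0%R].
  have sZ : is_subgroup Z.
    split=> [|y z [ky Ty] [kz Tz]].
      by split; [exact: subgroup1|exact: (additive_on1 sQ TA)].
    have kVz := subgroupV sQ kz; split; first exact: (subgroupM sQ).
    by rewrite TA // (additive_onV sQ TA) // Ty Tz subr0.
  suff sub : lower_central P k.+2 `<=` Z by move=> /sub[].
  apply: generated_sub => // _ [y ky [g Pg <-]]; split; last exact: T0.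
  by apply: lower_central_sub => //; apply: lower_central_comm.
have phi_k x : lower_central P k.+2 x -> lower_central N k.+1 x -> phi k x = 0%R.
  by move=> /T0' Tx xk; apply: (rV_int_mulrn_eq0 m0); rewrite -Tphi.
split=> //; have sP2 := lower_central_subgroup k.+1 sP.
apply: finite_index_in_trans phi_fin.
apply: (finite_index_in_sub _ _ (finite_index_in_cap sP2 ik)).
  by move=> x xk; split=> //; apply: lower_central_sub.
by move=> x [xN xP]; split=> //; apply: phi_k.
Qed.

Lemma lower_central_coordinates k x : (k < c)%N ->
  lower_central P k.+2 x -> lower_central N k.+1 x -> phi k x = 0%R.
Proof.
move=> kc; suff H j : (j <= c)%N ->
    finite_index_in (lower_central P j.+1) (lower_central N j.+1).
  by case: (lower_central_finite_index_step kc (H k (ltnW kc))) => + _; apply.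
elim: j => [//|j IH] jc; case: (lower_central_finite_index_step jc) => //.
by apply: IH; apply: ltnW.
Qed.

Lemma coordinates_independent_above k : (k < c)%N ->
  independent_modulo (lower_central P k.+1) (lower_central P k.+2) (@b k).
Proof.
move=> kc; have [phiA bA phib _ _] := phiP kc; split=> [i|e Pe i]; first exact: lcNP.
have kS := lower_central_section k sN; have sG := lower_central_subgroup k sN.
have Ne : lower_central N k.+1 (\prod_(i < r k) zexpg (b i) (e i)).
  by apply: subgroup_prod => // j _; apply: subgroupZ.
have := lower_central_coordinates kc Pe Ne.
rewrite (coordinates_prod kS (phiP kc)) // => /rowP/(_ i).
rewrite (_ : (\matrix_(_ < _) _)%R = 1%:M%R) ?mulmx1 ?mxE //.
by apply/row_matrixP => j; rewrite rowK phib rowE mulmx1.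
Qed.

End Transfer.

(** * The integral representation on the torsion-free quotients *)

Section MaxGLZ.
Local Open Scope ring_scope.

Lemma max_GLZ_order_ge k (S : {fset 'M[int]_k}) : is_GLZ_subgroup S ->
  max_GLZ_order k != 0%N -> (#|` S| <= max_GLZ_order k)%N.
Proof.
rewrite /max_GLZ_order; set A := [set m | _] => GS sup0.
have : supremums A !=set0.
  apply: contrapT => noS; move/eqP: sup0; apply; rewrite /supremum.
  case: ifP => // _; case: xgetP => // n _ supn; case: noS; by exists n.
by move/ge_supremum_Nmem => /(_ 0%N #|` S|); rewrite leEnat; apply; exists S.
Qed.

Lemma is_GLZ_subgroup1 k : is_GLZ_subgroup [fset (1%:M : 'M[int]_k)]%fset.
Proof.
split=> [A||A B]; rewrite ?inE //; first by move/eqP ->; apply: unitmx1.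
by move=> /eqP -> /eqP ->; rewrite invmx1 mulmx1.
Qed.

(** A nonzero value in dimension [d] says that the orders are bounded there, hence
   also in dimension [h], by adding an identity block. *)
Lemma max_GLZ_order_le h d : (h <= d)%N -> max_GLZ_order d != 0%N ->
  (0 < max_GLZ_order h <= max_GLZ_order d)%N.
Proof.
move=> hd; rewrite -(subnKC hd); move: (d - h)%N => n d0 {hd}.
pose f (A : 'M[int]_h) : 'M[int]_(h + n) := block_mx A 0 0 1%:M.
have f_inj : injective f by move=> A B /eq_block_mx[].
have fM A B : f A *m f B = f (A *m B).
  by rewrite /f mulmx_block !mul0mx !mulmx0 mulmx1 !addr0 !add0r.
have f1 : f 1%:M = 1%:M by rewrite /f -scalar_mx_block.
have fV A : A \in unitmx -> f A \in unitmx /\ invmx (f A) = f (invmx A).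
  move=> uA; have AV : f A *m f (invmx A) = 1%:M by rewrite fM mulmxV.
  have [uf _] := mulmx1_unit AV; split=> //.
  by rewrite -[RHS](mulKmx uf) AV mulmx1.
have le_all (S : {fset 'M[int]_h}) : is_GLZ_subgroup S -> (#|` S| <= max_GLZ_order (h + n))%N.
  move=> [SU S1 SD]; have -> : #|` S| = #|` [fset f A | A in S]%fset| by rewrite card_imfset.
  apply: max_GLZ_order_ge => //; split.
  - by move=> _ /imfsetP[A /= AS ->]; case: (fV A (SU _ AS)).
  - by apply/imfsetP; exists 1%:M; rewrite ?f1.
  - move=> _ _ /imfsetP[A /= AS ->] /imfsetP[B /= BS ->].
    rewrite (fV B (SU _ BS)).2 fM; apply/imfsetP.
    by exists (A *m invmx B) => //=; apply: SD.
rewrite {1 2}/max_GLZ_order; set T := [set m | _].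
have T1 : T 1%N by exists [fset 1%:M]%fset; rewrite ?cardfs1 //; apply: is_GLZ_subgroup1.
have ubT : ubound T (max_GLZ_order (h + n)) by move=> _ [S GS <-]; rewrite leEnat; apply: le_all.
have := @nat_supremums_neq0 T; case; first by exists (max_GLZ_order (h + n)).
move=> s [us ls]; have -> : supremum 0%N T = s.
  rewrite /supremum ifF; last by apply/negP => /eqP T0; rewrite T0 in T1.
  by apply: xget_subset1 => //; apply: is_subset1_supremums.
by apply/andP; split; [have := us _ T1; rewrite leEnat|have := ls _ ubT; rewrite leEnat].
Qed.

End MaxGLZ.

Section Representation.
Local Open Scope group_scope.
Variables (G : groupType) (N : set G) (c : nat) (r : nat -> nat).
Variables (phi : forall k, G -> 'rV[int]_(r k)) (b : forall k, 'I_(r k) -> G).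
Hypotheses (sN : is_subgroup N) (nN : normal_in N [set: G]).
Hypothesis phiP : forall k, (k < c)%N ->
  coordinates (lower_central N k.+1) (lower_central N k.+2) (phi k) (@b k).
Implicit Types (x y g : G).

Let lcNJ k x g : lower_central N k.+1 x -> lower_central N k.+1 (x ^ g).
Proof. by apply: lower_central_normalizes; apply: nN. Qed.

Lemma zexpgJ (H : groupType) (x g : H) z : (zexpg x z) ^ g = zexpg (x ^ g) z.
Proof. by case: z => m /=; rewrite ?conjVg conjXg. Qed.

Let rho k g : 'M[int]_(r k) := (\matrix_(j < r k) phi k (@b k j ^ g))%R.

Let rhoE k x g : (k < c)%N -> lower_central N k.+1 x ->
  phi k (x ^ g) = (phi k x *m rho k g)%R.
Proof.
move=> kc xk; have sG := lower_central_subgroup k sN.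
have kS := lower_central_section k sN.
have [phiA bA phib _ _] := phiP kc.
pose y := \prod_(j < r k) zexpg (@b k j) (phi k x ord0 j).
have Ky : lower_central N k.+1 y by apply: subgroup_prod => // j _; apply: subgroupZ.
have xE : (\row_i phi k x ord0 i = phi k x)%R by apply/rowP => i; rewrite mxE.
have yx : phi k x = phi k y.
  rewrite (coordinates_prod kS (phiP kc)) // xE.
  rewrite (_ : (\matrix_(_ < _) _)%R = 1%:M%R) ?mulmx1 //.
  by apply/row_matrixP => j; rewrite rowK phib rowE mulmx1.
rewrite (coordinates_conj_eq sN nN phiP kc I xk Ky yx) /y conjg_prod.
under eq_bigr do rewrite zexpgJ.
by rewrite (coordinates_prod kS (phiP kc)) ?xE // => j; apply: lcNJ.
Qed.

Let rhoM k g h : (k < c)%N -> rho k (g * h) = (rho k g *m rho k h)%R.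
Proof.
move=> kc; have [_ bA _ _ _] := phiP kc.
apply/row_matrixP => j; rewrite row_mul !rowK conjgM rhoE //; exact: lcNJ.
Qed.

Let rho_triv k g : (k < c)%N -> N g -> rho k g = 1%:M%R.
Proof.
move=> kc Ng; have [phiA bA phib _ _] := phiP kc.
have sG := lower_central_subgroup k sN.
apply/row_matrixP => j; rewrite rowK rowE mulmx1 -phib.
apply/esym/(additive_on_eq sG phiA) => //; first exact: lcNJ.
apply: (coordinates_eq0 (lower_central_section k sN) (phiP kc)).
exact: lower_central_comm.
Qed.

(** The diagonal blocks are the actions by conjugation on the torsion-free
   quotients Z^(r k). *)
Lemma representation : exists rho : G -> 'M[int]_(\sum_(k < c) r k),
  [/\ forall g h, rho (g * h) = (rho g *m rho h)%R,
      forall g, N g -> rho g = 1%:M%R &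
      forall g, rho g = 1%:M%R -> forall k x, (k < c)%N ->
        lower_central N k.+1 x -> phi k (x ^ g) = phi k x].
Proof.
suff H j : (j <= c)%N -> exists n, exists2 rho' : G -> 'M[int]_n,
    n = (\sum_(k < j) r k)%N &
    [/\ forall g h, rho' (g * h) = (rho' g *m rho' h)%R,
      forall g, N g -> rho' g = 1%:M%R &
      forall g, rho' g = 1%:M%R -> forall k x, (k < j)%N ->
        lower_central N k.+1 x -> phi k (x ^ g) = phi k x].
  by have [n [rho' nE HH]] := H c (leqnn c); move: nE rho' HH => -> rho' HH; exists rho'.
elim: j => [_|j IH jc].
  exists 0%N, (fun=> 1%:M%R); first by rewrite big_ord0.
  by split=> // g h; rewrite mulmx1.
have [n [rho' nE [rM rN rK]]] := IH (ltnW jc).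
exists (n + r j)%N, (fun g => block_mx (rho' g) 0 0 (rho j g))%R.
  by rewrite big_ord_recr /= nE.
split=> [g h|g Ng|g].
- by rewrite mulmx_block !mul0mx !mulmx0 !addr0 !add0r rM rhoM.
- by rewrite rN // rho_triv // -scalar_mx_block.
- rewrite scalar_mx_block => /eq_block_mx[r1 _ _ r2] k x; rewrite ltnS leq_eqVlt.
  case/predU1P=> [->|kj] xk; last exact: (rK _ r1).
  by rewrite rhoE // r2 mulmx1.
Qed.

End Representation.

Section Kernel.
Local Open Scope group_scope.
Variables (G : groupType) (N : set G) (n : nat) (rho : G -> 'M[int]_n).
Hypotheses (sN : is_subgroup N) (iN : finite_index_in [set: G] N).
Hypothesis rhoM : forall g h, rho (g * h) = (rho g *m rho h)%R.
Hypothesis rhoN : forall g, N g -> rho g = 1%:M%R.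

Lemma rho1 : rho 1 = 1%:M%R. Proof. by apply: rhoN; apply: subgroup1. Qed.

Lemma rhoV g : rho g \in unitmx /\ rho g^-1 = invmx (rho g).
Proof.
have gV : (rho g *m rho g^-1 = 1%:M)%R by rewrite -rhoM mulgV rho1.
have [ug _] := mulmx1_unit gV; split=> //.
by rewrite -[RHS]mulmx1 -gV mulKmx.
Qed.

Lemma kernel_eq g h : rho g = rho h <-> rho (g^-1 * h) = 1%:M%R.
Proof.
have [ug gV] := rhoV g; rewrite rhoM gV; split=> [<-|gh]; first by rewrite mulVmx.
by rewrite -[RHS](mulKVmx ug) gh mulmx1.
Qed.

Lemma kernel_subgroup : is_subgroup [set g | rho g = 1%:M%R].
Proof.
split=> [|g h /= g1 h1]; first exact: rho1.
by rewrite rhoM (rhoV h).2 g1 h1 invmx1 mulmx1.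
Qed.

Lemma finite_range : finite_set (range rho).
Proof.
have [F [f fP]] := iN; pose rep u := xget 1 [set x | f x = u].
apply: (@sub_finite_set _ _ ((rho \o rep) @` [set: F])).
  move=> _ [g _ <-]; exists (f g) => //=; apply/kernel_eq/rhoN/fP => //.
  by apply: (xgetPex 1 (P := [set x | f x = f g])); exists g.
by apply: finite_image; apply: finite_finset.
Qed.

Lemma range_GLZ_subgroup : is_GLZ_subgroup (fset_set (range rho)).
Proof.
have inR A : A \in fset_set (range rho) <-> exists g, rho g = A.
  rewrite in_fset_set ?inE; last exact: finite_range.
  by split=> [[g _ <-]|[g <-]]; exists g.
split=> [A /inR[g <-]||A B /inR[g <-] /inR[h <-]]; first by case: (rhoV g).
  by apply/inR; exists 1; apply: rho1.
by apply/inR; exists (g * h^-1); rewrite rhoM (rhoV h).2.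
Qed.

Lemma kernel_schreier (X : {fset G}) : generates X -> exists Y : {fset G},
  [set g | rho g = 1%:M%R] = generated [set` Y] /\
  forall y, y \in Y -> word_ball X (2 * #|` fset_set (range rho)|) y.
Proof.
move=> XG; have inR g : rho g \in fset_set (range rho).
  by rewrite in_fset_set ?inE; [exists g|apply: finite_range].
have [||Y [YE YX _]] := schreier XG kernel_subgroup
  (F := fset_set (range rho)) (f := fun g => [` inR g]%fset)
  (m := #|` fset_set (range rho)|).
- move=> x y; rewrite /= -kernel_eq; split=> [/(congr1 val)//|xy].
  exact: val_inj.
- by rewrite cardfE; apply: max_card.
- by exists Y.
Qed.

End Kernel.

(** * The degree of growth *)

Section Weights.

Lemma bernoulli_nat t n : (0 < t)%N -> (n * (t - 1) + 1 <= t ^ n)%N.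
Proof.
move=> t0; elim: n => [|n IH]; first by [].
rewrite expnS; apply: leq_trans (leq_mul (leqnn t) IH); nia.
Qed.

(** By induction on [c], the top weight multiplying the right-hand side by
   [2 ^ (c.+1 * r c)]. The hypothesis gives [c <= D] for the exponent [D] of the
   previous weights when [r c] > 0, which is what the step needs. *)
Lemma weights_le c (r : nat -> nat) :
    (forall k, (k.+1 < c)%N -> (0 < r k.+1)%N -> (0 < r k)%N) ->
  (\sum_(k < c) r k * ((2 * k + 1) * 2 ^ k) < 2 ^ (\sum_(k < c) k.+1 * r k))%N.
Proof.
elim: c => [|c IH] r_pos; first by rewrite !big_ord0.
rewrite !big_ord_recr /=; have {}IH := IH (fun k kc => r_pos k (ltnW kc)).
have [->|rc] := posnP (r c); first by rewrite muln0 mul0n !addn0.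
have r_gt0 k : (k <= c)%N -> (0 < r k)%N.
  move=> kc; rewrite -(subKn kc); move: (c - k)%N => i; elim: i => [|i IHi].
    by rewrite subn0.
  have [ci|ic] := leqP c i; first by rewrite (_ : c - i.+1 = c - i)%N //; lia.
  by apply: r_pos; [lia|rewrite -subSn // subSS].
have cD : (c <= \sum_(k < c) k.+1 * r k)%N.
  rewrite -[c in X in (X <= _)%N]card_ord -sum1_card.
  by apply: leq_sum => k _; rewrite muln_gt0 /= r_gt0 // ltnW.
move: IH cD; set S := (\sum_(k < c) r k * _)%N; set D := (\sum_(k < c) _ * _)%N => IH cD.
rewrite expnD expnM; have t0 : (0 < 2 ^ c.+1)%N by rewrite expn_gt0.
have B := bernoulli_nat (r c) t0.
have cD2 : (2 ^ c <= 2 ^ D)%N by rewrite leq_exp2l.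
have c2 : (c < 2 ^ c)%N by apply: ltn_expl.
apply: leq_trans (leq_mul (leqnn _) B).
rewrite mulnDr muln1 [X in (_ <= X)%N]addnC -addSn; apply: leq_add => //.
have W : ((2 * c + 1) * 2 ^ c <= 2 ^ D * (2 ^ c.+1 - 1))%N.
  by rewrite mulnC; apply: leq_mul => //; rewrite expnS; lia.
by rewrite [X in (_ <= X)%N]mulnCA leq_mul2l W orbT.
Qed.

End Weights.

Section Exponents.
Local Open Scope ring_scope.
Variables (R : realType) (G : groupType) (X : {fset G}).

Lemma growth_gt0 n : (0 < growth X n)%N.
Proof.
apply: (@growth_ge _ _ _ [:: 1%g]) => // g; rewrite inE => /eqP ->.
exact: ball1.
Qed.

Lemma leq_growth m n : (m <= n)%N -> (growth X m <= growth X n)%N.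
Proof.
move=> mn; apply: growth_ge; first exact: fset_uniq.
move=> g; rewrite in_fset_set ?inE; last exact: finite_ball.
exact: ball_le.
Qed.

(** Otherwise q^(D-a) would be bounded. *)
Lemma growth_exponent_ge D A (a : R) : (0 < A)%N ->
  (forall q, (0 < q)%N -> (q ^ D <= growth X (A * q))%N) ->
  growth_exponents X a -> D%:R <= a.
Proof.
move=> A0 AD [C aC]; rewrite leNgt; apply/negP => aD.
pose e := D%:R - a; have e0 : 0 < e by rewrite subr_gt0.
pose M := C * A%:R `^ a.
have qM q : (0 < q)%N -> q%:R `^ e <= M.
  move=> q0; have qR : (0 : R) < q%:R by rewrite ltr0n.
  have := aC (A * q)%N; rewrite muln_gt0 A0 => /(_ q0).
  have := AD q q0; rewrite -(ler_nat R) natrX => le1 le2.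
  have := le_trans le1 le2; rewrite natrM powRM ?ler0n // mulrA -/M.
  rewrite -powR_mulrn ?ler0n // -[D%:R](subrK a) -/e powRD; last first.
    by apply/implyP => _; rewrite gt_eqF.
  by rewrite ler_pM2r // powR_gt0.
pose x := (`|M| + 1) `^ e^-1; pose q := (Num.bound x).+1.
have x0 : 0 <= x by apply: powR_ge0.
have xq : x <= q%:R.
  by apply: ltW; apply: lt_le_trans (archi_boundP x0) _; rewrite ler_nat.
have := qM q isT; have : x `^ e <= q%:R `^ e.
  by apply: ge0_ler_powR; rewrite ?nnegrE ?ler0n // ltW.
rewrite /x -powRrM mulVf ?gt_eqF // powRr1; last by rewrite addr_ge0.
move=> le1 le2; have := le_trans le1 le2.
by apply/negP; rewrite -ltNge; apply: le_lt_trans (ler_norm M) _; rewrite ltrDl.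
Qed.

Lemma growth_degree_le (a : R) : growth_exponents X a -> growth_degree R X <= a.
Proof.
apply: ge_inf; exists 0 => e; apply: (@growth_exponent_ge 0 1) => // q _.
by rewrite expn0 growth_gt0.
Qed.

Lemma growth_degree_ge D A : (0 < A)%N -> has_polynomial_growth R X ->
  (forall q, (0 < q)%N -> (q ^ D <= growth X (A * q))%N) ->
  D%:R <= growth_degree R X.
Proof.
move=> A0 Xpol AD; apply: lb_le_inf => // a; exact: growth_exponent_ge AD.
Qed.

Lemma covered_growth_exponent D C :
  (forall n, (0 < n)%N -> covered (C * n ^ D) (word_ball X n)) ->
  growth_exponents X (D%:R : R).
Proof.
move=> XC; exists C%:R => n n0; have [s sN Xs] := XC n n0.
rewrite powR_mulrn ?ler0n // -natrX -natrM ler_nat.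
by apply: leq_trans sN; apply: growth_le.
Qed.

End Exponents.

Section LowerCentralCoordinates.
Local Open Scope group_scope.
Variables (G : groupType).
Implicit Types (K : set G) (Y X : {fset G}).

Lemma lower_central_coordinates_exist K Y : K = generated [set` Y] ->
  exists (r : nat -> nat) (phi : forall k, G -> 'rV[int]_(r k))
    (b : forall k, 'I_(r k) -> G), forall k,
    coordinates (lower_central K k.+1) (lower_central K k.+2) (phi k) (@b k).
Proof.
move=> KE; have sK : is_subgroup K by rewrite KE; apply: generated_subgroup.
pose T := {r : nat & ((G -> 'rV[int]_r) * ('I_r -> G))%type}.
have /choice[f fP] : forall k, exists p : T,
    coordinates (lower_central K k.+1) (lower_central K k.+2) (projT2 p).1 (projT2 p).2.
  move=> k; have [r [phi [b kb]]] := coordinates_exist (lower_central_section k sK)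
    (simple_commutators_generate k KE).
  by exists (existT _ r (phi, b)).
by exists (fun k => projT1 (f k)), (fun k => (projT2 (f k)).1), (fun k => (projT2 (f k)).2).
Qed.

(** A torsion quotient of the lower central series is followed by torsion
   quotients, by bimultiplicativity of the commutator. *)
Lemma lower_central_rank_gt0 K Y (r : nat -> nat) (phi : forall k, G -> 'rV[int]_(r k))
    (b : forall k, 'I_(r k) -> G) k : K = generated [set` Y] ->
    (forall k, coordinates (lower_central K k.+1) (lower_central K k.+2) (phi k) (@b k)) ->
  (0 < r k.+1)%N -> (0 < r k)%N.
Proof.
move=> KE phiP rk1; have sK : is_subgroup K by rewrite KE; apply: generated_subgroup.
have YK y : y \in Y -> K y by move=> yY; rewrite KE; apply: sub_generated.
rewrite lt0n; apply/negP => /eqP rk0.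
have kS := lower_central_section k.+1 sK.
have [f [xK xind]] := independent_generators kS (phiP k.+1)
  (simple_commutators_generate k.+1 KE).
pose j0 := Ordinal rk1.
have : nth 1 (simple_commutators Y k.+1) (f j0) \in simple_commutators Y k.+1.
  exact: mem_nth.
move=> /allpairsP[[x y] /= [xS yY xyE]].
have xk := simple_commutators_lower_central KE xS.
have [_ _ _ phi0 _] := phiP k; have [|m m0 xm] := (phi0 x xk).1.
  by apply/rowP => i; have := ltn_ord i; rewrite [X in (_ < X)%N]rk0.
have := lower_central_commX KE (E := 1) (A := m) 1%N _ xk (YK y yY).
rewrite expg1 comm1g invg1 mul1g muln1 mul1g => H.
have {}H := H (subgroup1 (lower_central_subgroup k sK)) xm.
have := xind (fun j => if j == j0 then Posz m else 0%R) _ j0.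
rewrite eqxx => H'; suff : Posz m = 0%R by move=> [m0']; rewrite m0' in m0.
apply: H'; rewrite (big_only1 j0) // => [|j /negPf -> //].
by rewrite eqxx /= xyE.
Qed.

End LowerCentralCoordinates.

Section MainTheorem.
Local Open Scope group_scope.
Variable G : groupType.
Implicit Types (H K N : set G) (X Y : {fset G}).

Lemma nilpotency_classP H : nilpotent H ->
  lower_central H (nilpotency_class H).+1 = [set 1].
Proof.
move=> nH; rewrite /nilpotency_class; set A := [set c | _].
have exA : exists c, `[< A c >] by case: nH => c ?; exists c; apply/asboolP.
have [m /asboolP Am mmin] := ex_minnP exA.
suff -> : infimum 0%N A = m by [].
have im : infimums A m.
  by split=> [c Ac|c]; [rewrite leEnat; apply: mmin; apply/asboolP|apply].
rewrite /infimum ifF; last by apply/negP => /eqP A0; rewrite A0 in Am.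
by apply: xget_subset1 => //; apply: is_subset1_infimums.
Qed.

Lemma hirsch_length_ranks H (r : nat -> nat) (phi : forall k, G -> 'rV[int]_(r k))
    (b : forall k, 'I_(r k) -> G) : is_subgroup H ->
    (forall k, coordinates (lower_central H k.+1) (lower_central H k.+2) (phi k) (@b k)) ->
  nilpotent_hirsch_length H = (\sum_(k < nilpotency_class H) r k)%N.
Proof.
move=> sH phiP; rewrite /nilpotent_hirsch_length big_add1 big_mkord.
apply: eq_bigr => k _; exact: (torsion_free_rank_coordinates (lower_central_section k sH) (phiP k)).
Qed.

Lemma finitely_generated_finite_index X H : generates X -> is_subgroup H ->
    finite_index_in [set: G] H ->
  exists (l : nat) (Y : {fset G}), [/\ H = generated [set` Y],
    forall y, y \in Y -> word_ball X l y &
    exists T : seq G, forall n g, word_ball X n g ->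
      exists t h, [/\ t \in T, word_ball Y n h & g = t * h]].
Proof.
move=> XG sH iH; have [//|//|F [f fP]] := finite_index_cosets _ sH _ iH.
have [|Y HY] := schreier XG sH (fun x y => fP x y I I) (m := #|F|); first exact: max_card.
by exists (2 * #|F|)%N, Y.
Qed.

Lemma growth_degree_ge_ranks (R : realType) X H c (r : nat -> nat)
    (phi : forall k, G -> 'rV[int]_(r k)) (b : forall k, 'I_(r k) -> G) :
    generates X -> has_polynomial_growth R X -> is_subgroup H ->
    finite_index_in [set: G] H ->
    (forall k, coordinates (lower_central H k.+1) (lower_central H k.+2) (phi k) (@b k)) ->
  ((\sum_(k < c) k.+1 * r k)%N%:R <= growth_degree R X)%R.
Proof.
move=> XG Xpol sH iH phiP.
have [l [Y [HE YX _]]] := finitely_generated_finite_index XG sH iH.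
pose C := (\sum_(k < c) r k * ((2 * k + 1) * 2 ^ k))%N.
apply: (@growth_degree_ge _ _ _ _ (l * C).+1) => // q q0.
apply: leq_trans (growth_lower_bound (c := c) HE YX (fun k _ => phiP k) q0) _.
by apply: leq_growth; rewrite mulnA leq_mul2r leqnSn orbT.
Qed.

Lemma growth_degree_le_ranks (R : realType) X N c (r : nat -> nat)
    (phi : forall k, G -> 'rV[int]_(r k)) (b : forall k, 'I_(r k) -> G) :
    generates X -> is_subgroup N -> finite_index_in [set: G] N ->
    lower_central N c.+1 = [set 1] ->
    (forall k, coordinates (lower_central N k.+1) (lower_central N k.+2) (phi k) (@b k)) ->
  (growth_degree R X <= (\sum_(k < c) k.+1 * r k)%N%:R)%R.
Proof.
move=> XG sN iN Nc phiP; apply: growth_degree_le.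
have [l [Y [NE _ [T XT]]]] := finitely_generated_finite_index XG sN iN.
have [C HC] := nilpotent_ball_covered NE Nc (fun k _ => phiP k).
apply: (@covered_growth_exponent _ _ _ _ (size T * C)) => n n0.
have TT : covered (size T) [set t | t \in T] by exists T.
have := coveredM TT (HC n n0); rewrite mulnA; apply: covered_le => // g gn.
by have [t [h [tT hn ->]]] := XT n g gn; exists t => //; exists h.
Qed.

(** The lower bound is used with [q] of order [n / (2 * m * 2 ^ d)]: one factor 2
   comes from the length of the generators, [2 ^ d] from [weights_le], and another
   factor 2 from rounding, which makes [2 ^ (d + 2) * m] in all. *)
Lemma growth_lower_bound_finite_index X K Y d m c (r : nat -> nat)
    (phi : forall k, G -> 'rV[int]_(r k)) (b : forall k, 'I_(r k) -> G) :
    K = generated [set` Y] -> (forall y, y \in Y -> word_ball X (2 * m) y) ->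
    (0 < m)%N ->
    (forall k, coordinates (lower_central K k.+1) (lower_central K k.+2) (phi k) (@b k)) ->
    (\sum_(k < c) k.+1 * r k = d)%N ->
  forall n, (n ^ d <= 2 ^ (d * (d + 2)) * m ^ d * growth X n)%N.
Proof.
move=> KE YX m0 phiP dE n.
have r_pos k : (k.+1 < c)%N -> (0 < r k.+1)%N -> (0 < r k)%N.
  by move=> _; apply: lower_central_rank_gt0 KE phiP.
have := weights_le r_pos; rewrite dE; set C := (\sum_(k < c) _)%N => C2.
pose l := (2 * m * 2 ^ d)%N; have l0 : (0 < l)%N by rewrite !muln_gt0 m0 expn_gt0.
have -> : (2 ^ (d * (d + 2)) * m ^ d = (2 * l) ^ d)%N.
  rewrite [(d * _)%N]mulnC expnM -expnMn; congr (_ ^ _)%N.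
  by rewrite /l expnD; ring.
have [nl|ln] := ltnP n l.
  apply: leq_trans (leq_pmulr _ (growth_gt0 X n)).
  by case: (d) => // d'; rewrite leq_exp2r //; lia.
pose q := (n %/ l)%N; have q0 : (0 < q)%N by rewrite divn_gt0.
have nq : (n <= 2 * l * q)%N.
  by have := divn_eq n l; have := ltn_pmod n l0; rewrite -/q; nia.
have qn : (l * q <= n)%N by rewrite mulnC leq_trunc_div.
apply: (@leq_trans ((2 * l * q) ^ d)); first by case: (d) => // d'; rewrite leq_exp2r.
rewrite expnMn leq_mul2l; apply/orP; right; rewrite -{1}dE.
apply: leq_trans (growth_lower_bound KE YX (fun k _ => phiP k) q0) _.
apply: leq_growth; apply: leq_trans qn.
by rewrite mulnA leq_mul2r; apply/orP; right; rewrite /l leq_mul2l (ltnW C2) orbT.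
Qed.

(** The subgroup [K] below consists of the elements acting trivially on the
   torsion-free quotients of the lower central series of a normal nilpotent
   subgroup of finite index. *)
Lemma growth_bound_hirsch (R : realType) (d : nat) X Y0 H :
    generates Y0 -> has_polynomial_growth R Y0 -> growth_degree R Y0 = d%:R%R ->
    generates X -> finite_index_nilpotent_subgroup H ->
    max_GLZ_order (nilpotent_hirsch_length H) != 0%N ->
  forall n, (n ^ d <=
    2 ^ (d * (d + 2)) * max_GLZ_order (nilpotent_hirsch_length H) ^ d * growth X n)%N.
Proof.
move=> YG Ypol Yd XG [sH /(finite_index_in_setT sH) iH nH] g0 n.
have Hc := nilpotency_classP nH; set c := nilpotency_class H in Hc.
have [N [sN NH nN iN]] := normal_core sH iH.
have [_ [YN [NE _ _]]] := finitely_generated_finite_index XG sN iN.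
have [_ [YH [HE _ _]]] := finitely_generated_finite_index XG sH iH.
have [r [phi [b phiP]]] := lower_central_coordinates_exist NE.
have [rH [phiH [bH phiHP]]] := lower_central_coordinates_exist HE.
have Nc : lower_central N c.+1 = [set 1].
  apply/seteqP; split=> [x /(lower_central_mono NH)|x ->]; first by rewrite Hc.
  exact: (subgroup1 (lower_central_subgroup c sN)).
have rank_le P rP (phiP' : forall k, G -> 'rV[int]_(rP k)) (bP : forall k, 'I_(rP k) -> G) :
    is_subgroup P -> N `<=` P ->
    (forall k, coordinates (lower_central P k.+1) (lower_central P k.+2) (phiP' k) (@bP k)) ->
    (forall k x g, (k < c)%N -> lower_central N k.+1 x -> P g -> phi k (x ^ g) = phi k x) ->
  forall k, (k < c)%N -> (r k <= rP k)%N.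
  move=> sP NP HP trivP k kc.
  apply: (independent_modulo_le (lower_central_section k sP) (HP k) (x := @b k)).
  apply: (coordinates_independent_above sN sP NP _ _ (fun k _ => phiP k) trivP kc).
    by move=> g _; apply: nN.
  exact: finite_index_in_sub iN.
have rrH k : (k < c)%N -> (r k <= rH k)%N.
  apply: (rank_le H rH phiH bH) => // {}k x g kc xk Hg.
  apply: (unipotent_coordinates sN sH NH _ _ (fun k _ => phiP k) (n := c) Hg _ kc xk).
  - by move=> y _; apply: nN.
  - by apply: finite_index_in_sub iN.
  - move=> z Hz; suff : lower_central H c.+1 (iter c (fun z => [~ z, g]) z) by rewrite Hc.
    elim: (c) => [//|j IH]; rewrite iterS; exact: lower_central_comm.
have [rho [rhoM rhoN rhoK]] := representation sN nN (fun k _ => phiP k) (c := c).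
pose K := [set g | rho g = 1%:M%R]; pose m := #|` fset_set (range rho)|.
have sK : is_subgroup K := kernel_subgroup sN rhoM rhoN.
have [Y [KE YX]] := kernel_schreier sN iN rhoM rhoN XG.
have [rK [phiK [bK phiKP]]] := lower_central_coordinates_exist KE.
have rrK k : (k < c)%N -> (r k <= rK k)%N.
  apply: (rank_le K rK phiK bK) => //.
  by move=> {}k x g kc xk Kg; apply: (rhoK g Kg).
have iK : finite_index_in [set: G] K.
  by apply: finite_index_in_sub iN => // g Ng; apply: rhoN.
have degK : (\sum_(k < c) k.+1 * rK k = d)%N.
  apply/eqP; rewrite eqn_leq -!(ler_nat R) -Yd.
  rewrite (growth_degree_ge_ranks _ YG Ypol sK iK phiKP) /=.
  apply: le_trans (growth_degree_le_ranks R YG sN iN Nc phiP) _.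
  by rewrite ler_nat; apply: leq_sum => k _; rewrite leq_mul2l rrK // orbT.
have hE := hirsch_length_ranks sH phiHP; rewrite -/c in hE.
have mS : is_GLZ_subgroup (fset_set (range rho)) := range_GLZ_subgroup sN iN rhoM rhoN.
have m0 : (0 < m)%N.
  by case: mS => _ S1 _; rewrite cardfs_gt0; apply/fset0Pn; exists 1%:M%R.
have hr : (\sum_(k < c) r k <= nilpotent_hirsch_length H)%N.
  by rewrite hE; apply: leq_sum => k _; apply: rrH.
have /andP[gr0 gr] := max_GLZ_order_le hr g0.
have mg : (m <= max_GLZ_order (nilpotent_hirsch_length H))%N.
  by apply: leq_trans gr; apply: max_GLZ_order_ge => //; rewrite -lt0n.
apply: leq_trans (growth_lower_bound_finite_index KE YX m0 phiKP degK n) _.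
rewrite leq_mul2r leq_mul2l; apply/orP; right; apply/orP; right.
by case: (d) => // d'; rewrite leq_exp2r.
Qed.

Lemma hirsch_length_le_degree (R : realType) (d : nat) Y0 H :
    generates Y0 -> has_polynomial_growth R Y0 -> growth_degree R Y0 = d%:R%R ->
    finite_index_nilpotent_subgroup H ->
  (nilpotent_hirsch_length H <= d)%N.
Proof.
move=> YG Ypol Yd [sH /(finite_index_in_setT sH) iH nH].
have [_ [YH [HE _ _]]] := finitely_generated_finite_index YG sH iH.
have [r [phi [b phiP]]] := lower_central_coordinates_exist HE.
rewrite (hirsch_length_ranks sH phiP) -(ler_nat R) -Yd.
apply: le_trans (growth_degree_ge_ranks (nilpotency_class H) YG Ypol sH iH phiP).
by rewrite ler_nat; apply: leq_sum => k _; apply: leq_pmull.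
Qed.

End MainTheorem.

Local Open Scope ring_scope.

Theorem theorem1p5 (R : realType) (d : nat) (hd : (0 < d)%N) (G : groupType)
    (hG : virtually_nilpotent G)
    (hgrowth : @polynomial_growth_of_degree R G d%:R)
    (X : {fset G}) (hX : generates X) (n : nat) (hn : (0 < n)%N) :
  (growth X n)%:R >=
    n%:R ^+ d
      / (2 ^+ (d * (d + 2)) * (max_GLZ_order (hirsch_length G))%:R ^+ d) :> R
  /\
  n%:R ^+ d
      / (2 ^+ (d * (d + 2)) * (max_GLZ_order (hirsch_length G))%:R ^+ d) >=
    n%:R ^+ d / (2 ^+ (d * (d + 2)) * (max_GLZ_order d)%:R ^+ d) :> R.
Proof.
have [Y [YG Ypol Yd]] := hgrowth.
have HP : finite_index_nilpotent_subgroup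
    (xget [set: G] (@finite_index_nilpotent_subgroup G)) by apply: xgetPex.
rewrite /hirsch_length; move: (xget _ _) HP => H HP.
have hd' := hirsch_length_le_degree YG Ypol Yd HP.
set h := nilpotent_hirsch_length H in hd' *.
have zero k : max_GLZ_order k = 0%N ->
    n%:R ^+ d / (2 ^+ (d * (d + 2)) * (max_GLZ_order k)%:R ^+ d) = 0 :> R.
  by move=> ->; rewrite expr0n gtn_eqF // mulr0 invr0 mulr0.
have pos k : max_GLZ_order k != 0%N ->
    0 < 2 ^+ (d * (d + 2)) * (max_GLZ_order k)%:R ^+ d :> R.
  by move=> k0; rewrite mulr_gt0 ?exprn_gt0 // ltr0n lt0n.
have ge0 k : 0 <= n%:R ^+ d / (2 ^+ (d * (d + 2)) * (max_GLZ_order k)%:R ^+ d) :> R.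
  by rewrite divr_ge0 ?mulr_ge0 ?exprn_ge0 ?ler0n.
split.
  (* A zero value of the supremum makes the denominator, hence the quotient, 0. *)
  have [h0|h0] := eqVneq (max_GLZ_order h) 0%N; first by rewrite zero.
  rewrite ler_pdivrMr ?pos // mulrC -!natrX -!natrM ler_nat.
  exact: (growth_bound_hirsch YG Ypol Yd hX HP h0).
have [d0|d0] := eqVneq (max_GLZ_order d) 0%N; first by rewrite zero.
have /andP[h0 hle] := max_GLZ_order_le hd' d0.
rewrite ler_wpM2l ?exprn_ge0 // lef_pV2 ?posrE ?pos // -?lt0n //.
by rewrite ler_wpM2l ?exprn_ge0 // lerXn2r ?nnegrE ?ler_nat.
Qed.
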